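(* If $A\in\mathbf{M}_n(\mathbb{C})$ is a normal matrix whose numerical range $W(A)\subset\mathbb{C}$ has nonempty interior, then the numerical density $f_A:\mathbb{C}\to\mathbb{R}_+$ of $A$ is the bivariate $B$-spline of degree $n-3$ whose knots are the eigenvalues $\lambda_1,\dots,\lambda_n$ of $A$ (repeated according to multiplicity), with equality almost everywhere.
   Context: $\mathbf{M}_n(\mathbb{C})$ is the space of complex $n\times n$ matrices; $A$ is normal if $AA^*=A^*A$. The numerical range is $W(A)=\{\langle Ax,x\rangle: x\in\mathbb{C}^n,\ \|x\|=1\}$ with $\langle x,y\rangle=y^*x$; here nonempty interior forces $n\ge3$ and that the eigenvalues are not collinear. The numerical measure $\mu_A$ is the image, under $x\mapsto\langle Ax,x\rangle$, of the normalized (probability) Euclidean surface measure on the unit sphere of $\mathbb{C}^n$. When $W(A)$ has nonempty interior, $\mu_A$ is absolutely continuous with respect to two-dimensional Lebesgue measure on $\mathbb{C}\simeq\mathbb{R}^2$, and the numerical density is $f_A=\mathrm{d}\mu_A/\mathrm{d}z$. Bivariate $B$-spline of degree $n-3$ with knots $\lambda_1,\dots,\lambda_n\in\mathbb{C}\simeq\mathbb{R}^2$ (not collinear): for $n=3$, it is $|T|^{-1}\mathbf{1}_T$, where $T$ is the triangle with vertices $\lambda_1,\lambda_2,\lambda_3$ and $|T|$ its area. For $n\ge4$, let $P:\mathbb{R}^{n-1}\to\mathbb{R}^2$, $P(x_1,\dots,x_{n-1})=(x_1,x_2)$, and let $S\subset\mathbb{R}^{n-1}$ be any $(n-1)$-simplex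 of unit $(n-1)$-dimensional volume with vertices $v_1,\dots,v_n$ satisfying $Pv_i=\lambda_i$ for $i=1,\dots,n$ (such simplices exist); the $B$-spline is the function $z\mapsto$ $(n-3)$-dimensional Lebesgue measure of $P^{-1}(z)\cap S$, which does not depend on the choice of $S$ (up to null sets). *)

(* Defs.v *)
From HB Require Import structures.
From mathcomp Require Import all_boot all_order all_algebra.
From mathcomp Require Import sesquilinear spectral.
From mathcomp Require Import complex.
From mathcomp Require Import all_classical all_reals all_analysis.
From mathcomp Require Import measurable_realfun.
Set Implicit Arguments.
Unset Strict Implicit.
Unset Printing Implicit Defensive.
Import Order.TTheory GRing.Theory Num.Theory.
Import numFieldNormedType.Exports.
Local Open Scope classical_set_scope.
Local Open Scope ring_scope.
Local Open Scope complex_scope.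
Local Open Scope sesquilinear_scope.

(* The canonical sigma-finite structure on a product measure found by
   unification is the one for subprobabilities, hence this explicit proof. *)
Lemma sigma_finite_product d1 d2 (T1 : measurableType d1)
    (T2 : measurableType d2) (R : realType)
    (m1 : {sigma_finite_measure set T1 -> \bar R})
    (m2 : {sigma_finite_measure set T2 -> \bar R}) :
  sigma_finite setT (m1 \x m2)%E.
Proof.
have /sigma_finiteP[F [TF ndF Foo]] := sigma_finiteT m1.
have /sigma_finiteP[G [TG ndG Goo]] := sigma_finiteT m2.
exists (fun n => F n `*` G n).
  rewrite -setXTT TF TG predeqE => -[x y]; split.
    move=> [/= [n _ Fnx] [k _ Gky]]; exists (maxn n k) => //; split.
    - by move: x Fnx; exact/subsetPset/ndF/leq_maxl.
    - by move: y Gky; exact/subsetPset/ndG/leq_maxr.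
  by move=> [n _ []/= ? ?]; split; exists n.
move=> k; have [? ?] := Foo k; have [? ?] := Goo k.
split; first exact: measurableX.
by rewrite product_measure1E// lte_mul_pinfty// ge0_fin_numE.
Qed.

Section cons_measure.
Local Open Scope ereal_scope.
Context d (T : measurableType d) (R : realType).
Variable mu : {sigma_finite_measure set T -> \bar R}.
Variables (n : nat) (nu : {sigma_finite_measure set (n.-tuple T) -> \bar R}).

Definition cons_pair (p : T * n.-tuple T) : n.+1.-tuple T :=
  [tuple of p.1 :: p.2].

Lemma measurable_cons_pair : measurable_fun [set: T * n.-tuple T] cons_pair.
Proof. by apply: measurable_cons. Qed.

Definition cons_measure : set (n.+1.-tuple T) -> \bar R :=
  pushforward (mu \x nu) cons_pair.

HB.instance Definition _ := Measure.copy cons_measure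
  (measure_function_pushforward__canonical__measure_function_Measure
    (mu \x nu) measurable_cons_pair).

Let cons_measure_sigma_finite : sigma_finite setT cons_measure.
Proof.
have [F TF Foo] := sigma_finite_product mu nu.
pose g (t : n.+1.-tuple T) : T * n.-tuple T := (thead t, [tuple of behead t]).
have mg : measurable_fun setT g.
  apply/measurable_fun_pairP; split.
    exact: measurable_tnth.
  exact: measurable_behead.
have gK : cancel cons_pair g.
  by move=> [x t]; rewrite /g /cons_pair /= theadE; congr pair; apply/val_inj.
exists (fun k => g @^-1` F k).
  by rewrite -preimage_bigcup -TF preimage_setT.
move=> k; have [mF Fk] := Foo k; split.
  by rewrite -[X in measurable X]setTI; exact: mg.
rewrite /cons_measure /pushforward -comp_preimage (_ : g \o _ = id) //.
by apply/funext => p; exact: gK.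
Qed.

HB.instance Definition _ := Measure_isSigmaFinite.Build _ _ _ cons_measure
  cons_measure_sigma_finite.

End cons_measure.

(* The n-fold product measure mu^n. *)
Fixpoint pow_measure d (T : measurableType d) (R : realType)
    (mu : {sigma_finite_measure set T -> \bar R}) (n : nat) :
    {sigma_finite_measure set (n.-tuple T) -> \bar R} :=
  match n with
  | 0 => \d_ ([tuple] : 0.-tuple T)
  | m.+1 => cons_measure mu (pow_measure mu m)
  end.

Section lebesgue.
Context (R : realType).

Definition planar_lebesgue :
    set (measurableTypeR R * measurableTypeR R) -> \bar R :=
  (@lebesgue_measure R \x @lebesgue_measure R)%E.

HB.instance Definition _ := Measure.on planar_lebesgue.
HB.instance Definition _ := Measure_isSigmaFinite.Build _ _ _ planar_lebesgue
  (sigma_finite_product (@lebesgue_measure R) (@lebesgue_measure R)).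

(* Lebesgue measure on R^k, points being read as row vectors. *)
Definition volume k (E : set 'rV[R]_k) : \bar R :=
  pow_measure (@lebesgue_measure R) k [set t | E (\row_i tnth t i)].

Definition of_plane (p : R * R) : R[i] := p.1 +i* p.2.
Definition to_plane (z : R[i]) : R * R := (complex.Re z, complex.Im z).

Definition of_planes n (t : n.-tuple (R * R)) : 'cV[R[i]]_n :=
  \col_i of_plane (tnth t i).

(* Lebesgue measure on C^n = (R^2)^n. *)
Definition cvolume n (E : set 'cV[R[i]]_n) : \bar R :=
  pow_measure planar_lebesgue n [set t | E (of_planes t)].

End lebesgue.

Section numerical_measure.
Context (R : realType).

Definition inner n (x y : 'cV[R[i]]_n) : R[i] := (y ^t* *m x) 0 0.
Definition hnorm n (x : 'cV[R[i]]_n) : R[i] := sqrtC (inner x x).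
Definition sphere n : set 'cV[R[i]]_n := [set x | hnorm x = 1].

Definition qform n (A : 'M[R[i]]_n) (x : 'cV[R[i]]_n) : R[i] :=
  inner (A *m x) x.

Definition numerical_range n (A : 'M[R[i]]_n) : set R[i] :=
  qform A @` @sphere n.

Definition cone n (E : set 'cV[R[i]]_n) : set 'cV[R[i]]_n :=
  [set r%:C *: x | r in `]0, 1] & x in E].

(* Euclidean surface measure on the unit sphere of R^d = C^n, d = 2n, as defined
   through polar coordinates (Folland, Real Analysis, 2.49):
   sigma(E) = d * vol {r x | 0 < r <= 1, x in E}. *)
Definition surface_measure n (E : set 'cV[R[i]]_n) : \bar R :=
  ((n.*2)%:R%:E * cvolume (cone E))%E.

Definition numerical_measure n (A : 'M[R[i]]_n)
    (B : set (measurableTypeR R * measurableTypeR R)) : \bar R :=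
  ((fine (surface_measure (@sphere n)))^-1%:E *
   surface_measure (@sphere n `&` [set x | B (to_plane (qform A x))]))%E.

Definition sqnorm n (t : n.-tuple (R * R)) : R :=
  \sum_(i < n) ((tnth t i).1 ^+ 2 + (tnth t i).2 ^+ 2).

Lemma inner_of_planes n (t : n.-tuple (R * R)) :
  inner (of_planes t) (of_planes t) = (sqnorm t)%:C.
Proof.
rewrite /inner mxE /sqnorm rmorph_sum; apply: eq_bigr => i _ /=.
rewrite !mxE /of_plane; case: (tnth t i) => a b /=.
apply/eqP; rewrite eq_complex /= mulNr opprK !expr2 eqxx /=.
by rewrite mulNr (mulrC b a) subrr.
Qed.

Lemma qformZ n (A : 'M[R[i]]_n) (r : R) x :
  qform A (r%:C *: x) = (r ^+ 2)%:C * qform A x.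
Proof.
rewrite /qform /inner -scalemxAr.
have -> : (r%:C *: x) ^t* = r%:C *: x ^t*.
  by apply/matrixP => i j; rewrite !mxE rmorphM/= (_ : Num.conj r%:C = r%:C) //; exact: conjc_real.
by rewrite -scalemxAl -scalemxAr !mxE mulrA -rmorphM expr2.
Qed.

Lemma innerZ n (r : R) (x : 'cV[R[i]]_n) :
  inner (r%:C *: x) (r%:C *: x) = (r ^+ 2)%:C * inner x x.
Proof. by have := qformZ (1%:M) r x; rewrite /qform !mul1mx. Qed.

Lemma sphereE n (x : 'cV[R[i]]_n) : sphere x <-> inner x x = 1.
Proof.
rewrite /sphere /hnorm /=; split=> [h|->]; last exact: sqrtC1.
by rewrite -[LHS](sqrtCK) h expr1n.
Qed.

Lemma sqnorm_ge0 n (t : n.-tuple (R * R)) : 0 <= sqnorm t.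
Proof. by apply: sumr_ge0 => i _; rewrite addr_ge0 ?sqr_ge0. Qed.

Definition rayleigh n (A : 'M[R[i]]_n) (t : n.-tuple (R * R)) : R * R :=
  ((sqnorm t)^-1 * complex.Re (qform A (of_planes t)),
   (sqnorm t)^-1 * complex.Im (qform A (of_planes t))).

Lemma of_planes_surj n (x : 'cV[R[i]]_n) : exists t, of_planes t = x.
Proof.
exists [tuple to_plane (x i 0) | i < n].
apply/matrixP => i j; rewrite !mxE tnth_mktuple (ord1 j) /to_plane /of_plane.
by case: (x i 0).
Qed.

Lemma cone_preimageE n (A : 'M[R[i]]_n) (B : set (R * R)) :
  [set t | cone (@sphere n `&` [set x | B (to_plane (qform A x))])
             (of_planes t)] =
  [set t | 0 < sqnorm t <= 1] `&` rayleigh A @^-1` B.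
Proof.
apply/seteqP; split => t /=.
  move=> [r rI [x [Sx Bx] tE]].
  have /andP[r0 r1] : 0 < r <= 1 by move: rI; rewrite /= in_itv.
  have N : sqnorm t = r ^+ 2.
    have := inner_of_planes t; rewrite -tE innerZ.
    by move/sphereE : Sx => ->; rewrite mulr1 => -[].
  split; first by rewrite N exprn_gt0//= expr_le1// ltW.
  rewrite /rayleigh -tE qformZ N.
  have r20 : r ^+ 2 != 0 by rewrite gt_eqF// exprn_gt0.
  move: Bx; rewrite /= /to_plane /=; case: (qform A x) => a b /=.
  by rewrite !mul0r subr0 addr0 !mulKf.
move=> [/andP[N0 N1]]; rewrite /rayleigh => Bt.
pose r := Num.sqrt (sqnorm t).
have r0 : 0 < r by rewrite sqrtr_gt0.
have rE : r ^+ 2 = sqnorm t by rewrite sqr_sqrtr// ltW.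
have r20 : (r ^+ 2) != 0 by rewrite gt_eqF// exprn_gt0.
exists r; first by rewrite /= in_itv/= r0 /= -(@expr_le1 _ 2)// ?rE// ltW.
exists ((r^-1)%:C *: of_planes t); last first.
  by rewrite scalerA -rmorphM mulfV ?gt_eqF// scale1r.
split.
  apply/sphereE; rewrite innerZ inner_of_planes -rmorphM -rE exprVn mulVf//.
rewrite /= qformZ exprVn rE.
move: Bt; case: (qform A _) => a b /=.
by rewrite /to_plane /= !mul0r subr0 addr0.
Qed.

Definition cmeasurable d (T : measurableType d) (f : T -> R[i]) :=
  measurable_fun setT (fun t => complex.Re (f t) : R) /\
  measurable_fun setT (fun t => complex.Im (f t) : R).

Lemma cmeasurableM d (T : measurableType d) (f g : T -> R[i]) :
  cmeasurable f -> cmeasurable g -> cmeasurable (fun t => f t * g t).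
Proof.
move=> [f1 f2] [g1 g2]; split.
- rewrite (_ : (fun _ => _) = (fun t => complex.Re (f t) * complex.Re (g t)
    - complex.Im (f t) * complex.Im (g t))); last first.
    by apply/funext => t; case: (f t) => a b; case: (g t).
  by apply: measurable_funB; apply: measurable_funM.
- rewrite (_ : (fun _ => _) = (fun t => complex.Re (f t) * complex.Im (g t)
    + complex.Im (f t) * complex.Re (g t))); last first.
    by apply/funext => t; case: (f t) => a b; case: (g t).
  by apply: measurable_funD; apply: measurable_funM.
Qed.

Lemma cmeasurable_sum d (T : measurableType d) m (f : 'I_m -> T -> R[i]) :
  (forall i, cmeasurable (f i)) -> cmeasurable (fun t => \sum_(i < m) f i t).
Proof.
move=> mf; split.
- rewrite (_ : (fun _ => _) = (fun t => \sum_(i < m) complex.Re (f i t))).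
    by apply: measurable_sum => i; have [] := mf i.
  by apply/funext => t; rewrite raddf_sum.
- rewrite (_ : (fun _ => _) = (fun t => \sum_(i < m) complex.Im (f i t))).
    by apply: measurable_sum => i; have [] := mf i.
  by apply/funext => t; rewrite raddf_sum.
Qed.

Local Notation RR := (measurableTypeR R * measurableTypeR R)%type.

Lemma cmeasurable_coord n i :
  cmeasurable (fun t : n.-tuple RR => of_plane (tnth t i)).
Proof.
split => /=.
  apply: (@measurableT_comp _ _ _ _ _ _ (fun p : RR => p.1)).
    exact: measurable_fst.
  exact: measurable_tnth.
apply: (@measurableT_comp _ _ _ _ _ _ (fun p : RR => p.2)).
  exact: measurable_snd.
exact: measurable_tnth.
Qed.

Lemma cmeasurable_conj_coord n i :
  cmeasurable (fun t : n.-tuple RR => Num.conj (of_plane (tnth t i))).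
Proof.
have [h1 h2] := cmeasurable_coord i; split => //=.
exact: (measurable_funN h2).
Qed.

Lemma cmeasurable_qform n (A : 'M[R[i]]_n) :
  cmeasurable (fun t : n.-tuple RR => qform A (of_planes t)).
Proof.
rewrite (_ : (fun _ => _) = (fun t : n.-tuple RR => \sum_i
  (Num.conj (of_plane (tnth t i)) * \sum_j (A i j * of_plane (tnth t j))))).
  apply: cmeasurable_sum => i; apply: cmeasurableM.
    exact: cmeasurable_conj_coord.
  apply: cmeasurable_sum => j; apply: cmeasurableM.
    by split; exact: measurable_cst.
  exact: cmeasurable_coord.
apply/funext => t; rewrite /qform /inner mxE; apply: eq_bigr => i _.
rewrite !mxE; congr (_ * _); apply: eq_bigr => j _.
by rewrite mxE.
Qed.

Lemma measurable_sqnorm n :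
  measurable_fun setT (fun t : n.-tuple RR => sqnorm t).
Proof.
have [h _] := cmeasurable_qform (1%:M : 'M[R[i]]_n).
apply: eq_measurable_fun h => t _.
by rewrite /qform mul1mx inner_of_planes.
Qed.

Lemma measurable_rayleigh n (A : 'M[R[i]]_n) :
  measurable_fun setT (rayleigh A : n.-tuple RR -> RR).
Proof.
have [h1 h2] := cmeasurable_qform A.
have hV : measurable_fun setT (fun t : n.-tuple RR => (sqnorm t)^-1).
  rewrite (_ : (fun _ => _) = (fun t => sqnorm t `^ (-1))).
    apply: (@measurableT_comp _ _ _ _ _ _ (fun x : R => x `^ (-1))).
      exact: measurable_powR.
    exact: measurable_sqnorm.
  by apply/funext => t; rewrite powR_inv1// sqnorm_ge0.
apply: measurable_fun_pair.
  exact: (measurable_funM hV h1).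
exact: (measurable_funM hV h2).
Qed.

Definition cball n : set (n.-tuple RR) := [set t | 0 < sqnorm t <= 1].

Lemma measurable_cball n : measurable (@cball n).
Proof.
have -> : @cball n = setT `&` (fun t => sqnorm t) @^-1` `]0, 1].
  by apply/seteqP; split => t /=; rewrite in_itv //= => -[].
by apply: measurable_sqnorm.
Qed.

Definition box d (T : measurableType d) n (K : set T) : set (n.-tuple T) :=
  [set t | forall i, K (tnth t i)].

Lemma measurable_box d (T : measurableType d) (K : set T) n :
  measurable K -> measurable (@box _ _ n K).
Proof.
move=> mK; rewrite (_ : @box _ _ n K =
    \bigcap_(i in [set: 'I_n]) (fun t => tnth t i) @^-1` K); last first.
  by apply/seteqP; split=> [t h i _|t h i]; exact: h.
apply: fin_bigcap_measurable => // i _.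
by rewrite -[X in measurable X]setTI; exact: measurable_tnth.
Qed.

Lemma pow_measure_box d (T : measurableType d)
    (mu : {sigma_finite_measure set T -> \bar R}) (K : set T) n :
  measurable K -> (mu K < +oo)%E -> (pow_measure mu n (@box _ _ n K) < +oo)%E.
Proof.
move=> mK Koo; elim: n => [|n ih] /=; first by rewrite diracE ltry.
rewrite /cons_measure /pushforward /= (_ : _ @^-1` _ = K `*` @box _ _ n K).
  rewrite product_measure1E//; last exact: measurable_box.
  by rewrite lte_mul_pinfty// ge0_fin_numE.
apply/seteqP; split=> [[x t] /= h|[x t] [/= Kx Kt] i].
  split; first by have := h ord0; rewrite (tnth_nth x).
  by move=> i; have := h (lift ord0 i); rewrite /cons_pair !(tnth_nth x).
rewrite /cons_pair; case: (unliftP ord0 i) => [j ->|->].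
  by have := Kt j; rewrite !(tnth_nth x).
by rewrite (tnth_nth x).
Qed.

Lemma cball_finite n :
  (pow_measure (@planar_lebesgue R) n (@cball n) < +oo)%E.
Proof.
pose K : set RR := `[-1, 1] `*` `[-1, 1].
have mI : measurable (`[-1, 1]%classic : set (measurableTypeR R)).
  exact: measurable_itv.
have mK : measurable K by exact: measurableX.
have Koo : (planar_lebesgue K < +oo)%E.
  have Ioo : (@lebesgue_measure R `[(-1)%R, 1%R]%classic < +oo)%E.
    by rewrite lebesgue_measure_itv /=; case: ifP => _; rewrite ?ltry.
  rewrite /planar_lebesgue product_measure1E//.
  by rewrite lte_mul_pinfty// ge0_fin_numE.
apply: le_lt_trans (pow_measure_box n mK Koo).
apply: le_measure; rewrite ?inE; first exact: measurable_cball.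
  exact: measurable_box.
move=> t /= /andP[_ N1] i.
have : (tnth t i).1 ^+ 2 + (tnth t i).2 ^+ 2 <= 1.
  apply: le_trans N1; rewrite /sqnorm (bigD1 i)//= lerDl.
  by apply: sumr_ge0 => j _; rewrite addr_ge0 ?sqr_ge0.
have h (a b : R) : a ^+ 2 + b ^+ 2 <= 1 -> -1 <= a <= 1.
  move=> h; rewrite -ler_norml -(@expr_le1 _ 2)//.
  by rewrite real_normK ?num_real// (le_trans _ h)// lerDl sqr_ge0.
move=> hh; split; rewrite /= in_itv /=; first exact: h hh.
by apply: (h _ (tnth t i).1); rewrite addrC.
Qed.

Lemma numerical_const_ge0 n :
  0 <= (fine (surface_measure (@sphere n)))^-1 * (n.*2)%:R.
Proof.
rewrite mulr_ge0// invr_ge0 fine_ge0// /surface_measure mule_ge0//.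
Qed.

Section instances.
Variables (n : nat) (A : 'M[R[i]]_n).

Let nu : {measure set RR -> \bar R} := mscale (NngNum (numerical_const_ge0 n))
  (measure_function_pushforward__canonical__measure_function_Measure
    (mrestr (pow_measure (@planar_lebesgue R) n) (@measurable_cball n))
    (measurable_rayleigh A)).

Let numE : numerical_measure A = nu.
Proof.
apply/funext => B.
rewrite /numerical_measure /nu /= /mscale /pushforward /mrestr /= EFinM -muleA.
congr (_ * _)%E; rewrite /surface_measure; congr (_ * _)%E.
by rewrite /cvolume cone_preimageE setIC.
Qed.

Let num0 : numerical_measure A set0 = 0%E.
Proof. by rewrite numE measure0. Qed.

Let num_ge0 B : (0 <= numerical_measure A B)%E.
Proof. by rewrite numE measure_ge0. Qed.

Let num_sigma_additive : semi_sigma_additive (numerical_measure A).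
Proof. rewrite numE; exact: measure_semi_sigma_additive. Qed.

HB.instance Definition _ := isMeasure.Build _ _ _ (numerical_measure A)
  num0 num_ge0 num_sigma_additive.

Let num_fin : fin_num_fun (numerical_measure A).
Proof.
apply: lty_fin_num_fun => /=.
have -> : numerical_measure A setT = nu setT by rewrite numE.
apply: lte_mul_pinfty => //.
by rewrite /= /pushforward preimage_setT /mrestr setTI; exact: cball_finite.
Qed.

HB.instance Definition _ := Measure_isFinite.Build _ _ _ (numerical_measure A)
  num_fin.

End instances.

End numerical_measure.

Section numerical_density.
Context (R : realType).
Local Open Scope charge_scope.

(* If numerical_measure A were not absolutely continuous, 'd _ '/d _ would be
   the constant -oo, so that an almost everywhere equality with a nonnegative
   function includes absolute continuity. *)
Definition numerical_density n (A : 'M[R[i]]_n) :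
    measurableTypeR R * measurableTypeR R -> \bar R :=
  'd (charge_of_finite_measure (numerical_measure A)) '/d (@planar_lebesgue R).

End numerical_density.

Section bspline.
Context (R : realType).

Definition conv_hull m k (p : 'I_m -> 'rV[R]_k) : set 'rV[R]_k :=
  [set x | exists w : 'I_m -> R, [/\ forall i, 0 <= w i,
    \sum_i w i = 1 & x = \sum_i w i *: p i]].

Definition row2 (p : R * R) : 'rV[R]_2 := \row_j [:: p.1; p.2]`_j.

(* Vertices in R^(k+2) of a simplex of unit volume over the given knots; lsubmx
   keeps the first two coordinates.  The convex hull of k + 3 points of R^(k+2)
   is negligible unless they are affinely independent. *)
Definition lifts_knots k (knots : 'I_k.+3 -> R * R)
    (v : 'I_k.+3 -> 'rV[R]_(2 + k)) : Prop :=
  (forall i, lsubmx (v i) = row2 (knots i)) /\ volume (conv_hull v) = 1%E.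

(* B is the bivariate B-spline of degree k with the given knots; for k > 0 it is
   only determined up to the choice of the simplex, whence a relation. *)
Definition is_bspline (k : nat) (knots : seq R[i])
    (B : measurableTypeR R * measurableTypeR R -> \bar R) : Prop :=
  let knot (i : 'I_k.+3) := to_plane knots`_i in
  let triangle := conv_hull (row2 \o knot) in
  size knots = k.+3 /\
  if k == 0%N then
    B = fun z => ((fine (volume triangle))^-1 * \1_triangle (row2 z))%:E
  else
    exists2 v, lifts_knots knot v &
      B = fun z => volume [set t : 'rV[R]_k | conv_hull v (row_mx (row2 z) t)].

End bspline.

(* Main.v *)
(**
The spectral theorem and the unitary invariance of Lebesgue measure on C^n (up
to a constant) reduce to A = diag(lambda_1, ..., lambda_n), whose Rayleigh
quotient at x is sum_i s_i lambda_i / sum_i s_i with s_i = |x_i|^2.  Since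
|x_i|^2 pushes planar Lebesgue measure to a multiple of Lebesgue measure on the
half-line, the numerical measure of B is proportional to the volume of the
weights s >= 0 with 0 < sum_i s_i <= 1 and sum_i s_i lambda_i / sum_i s_i in B.
Let v_i be vertices of a simplex over the lambda_i.  The linear bijection
s |-> (sum_i s_i, sum_i s_i v_i) maps these weights to a truncated cone over the
part of the simplex that projects into B, and slicing the cone shows that its
volume is proportional to that of this part, i.e. to the integral over B of the
(n-3)-dimensional volumes of the fibres.

No Jacobian is ever computed: a measurable linear bijection multiplies Lebesgue
measure by some constant (uniqueness of Haar measure), and all constants are
recovered at the end from the fact that both measures are probabilities.
*)
Require Import Defs.
From mathcomp Require Import all_boot all_order all_algebra.
From mathcomp Require Import perm sesquilinear spectral.
From mathcomp Require Import complex.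
From mathcomp Require Import all_classical all_reals all_analysis.
From mathcomp Require Import measurable_realfun.
From mathcomp Require Import ring lra.
Set Implicit Arguments.
Unset Strict Implicit.
Unset Printing Implicit Defensive.
Import Order.TTheory GRing.Theory Num.Theory.
Import numFieldNormedType.Exports.
Local Open Scope classical_set_scope.
Local Open Scope ring_scope.

(** * Powers of a measure *)

Section pow_measure_theory.
Local Open Scope ereal_scope.

Lemma measurable_preimT d1 d2 (T1 : measurableType d1) (T2 : measurableType d2)
    (f : T1 -> T2) (E : set T2) :
  measurable_fun setT f -> measurable E -> measurable [set x | E (f x)].
Proof. by move=> mf mE; rewrite -[X in measurable X]setTI; exact: mf. Qed.

Lemma pow_measureS d (T : measurableType d) (R : realType)
    (mu : {sigma_finite_measure set T -> \bar R}) n (E : set (n.+1.-tuple T)) :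
  pow_measure mu n.+1 E =
  \int[mu]_x pow_measure mu n [set t | E (cons_pair (x, t))].
Proof.
rewrite /= /cons_measure /pushforward /product_measure1.
apply: eq_integral => x _ /=; congr (pow_measure _ _ _).
by apply/seteqP; split => t; rewrite /xsection /= inE.
Qed.

Lemma measurable_cons_section d (T : measurableType d) n
    (E : set (n.+1.-tuple T)) x :
  measurable E -> measurable [set t | E (cons_pair (x, t))].
Proof.
move=> mE; apply: measurable_preimT mE.
exact: (@measurable_cons _ _ _ _ (fun=> x) _ id).
Qed.

Lemma measurable_pow_section d (T : measurableType d) (R : realType)
    (mu : {sigma_finite_measure set T -> \bar R}) n (E : set (n.+1.-tuple T)) :
  measurable E ->
  measurable_fun setT
    (fun x => pow_measure mu n [set t | E (cons_pair (x, t))]).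
Proof.
move=> mE.
have mE' : measurable [set p | E (@cons_pair _ T n p)].
  by apply: measurable_preimT mE; exact: measurable_cons_pair.
have := measurable_fun_xsection (pow_measure mu n) mE'.
congr (measurable_fun _ _); apply/funext => x /=; congr (pow_measure _ _ _).
by apply/seteqP; split => t; rewrite /xsection /= inE.
Qed.

Definition map_coord T1 T2 n (f : 'I_n -> T1 -> T2) (t : n.-tuple T1) :
  n.-tuple T2 := [tuple f i (tnth t i) | i < n].

Lemma map_coord_cons T1 T2 n (f : 'I_n.+1 -> T1 -> T2) x (t : n.-tuple T1) :
  map_coord f [tuple of x :: t] =
  [tuple of f ord0 x :: map_coord (fun i => f (lift ord0 i)) t].
Proof.
apply: eq_from_tnth => i; rewrite tnth_mktuple.
case: (unliftP ord0 i) => [j ->|->]; last by rewrite !tnth0.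
by rewrite !tnthS tnth_mktuple.
Qed.

Lemma measurable_map_coord d1 d2 (T1 : measurableType d1)
    (T2 : measurableType d2) n (f : 'I_n -> T1 -> T2) :
  (forall i, measurable_fun setT (f i)) -> measurable_fun setT (map_coord f).
Proof.
move=> mf; apply/measurable_fun_tnthP => i.
rewrite (_ : _ \o _ = fun t => f i (tnth t i)); last first.
  by apply/funext => t; rewrite /= tnth_mktuple.
by apply: measurableT_comp => //; exact: measurable_tnth.
Qed.

(** By induction on [n], slicing along the first coordinate. The factors [c i] are only assumed on
    subsets of [K], so that the lemma covers both translations and dilations, with [K] the whole
    space, and the squared modulus, whose image is a half-line. *)
Lemma pow_measure_map d1 d2 (T1 : measurableType d1) (T2 : measurableType d2)
    (R : realType) (mu1 : {sigma_finite_measure set T1 -> \bar R})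
    (mu2 : {sigma_finite_measure set T2 -> \bar R}) (K : set T2) n
    (f : 'I_n -> T1 -> T2) (c : 'I_n -> {nonneg R}) :
  measurable K -> (forall i, measurable_fun setT (f i)) ->
  (forall i E, measurable E -> E `<=` K ->
     mu1 (f i @^-1` E) = (c i)%:num%:E * mu2 E) ->
  forall E, measurable E -> E `<=` @box _ _ n K ->
  pow_measure mu1 n (map_coord f @^-1` E) =
  (\prod_i (c i)%:num)%:E * pow_measure mu2 n E.
Proof.
move=> mK; elim: n f c => [|n IH] f c mf fE E mE EK.
  have m0 t : map_coord f t = [tuple] by exact: tuple0.
  rewrite big_ord0 mul1e /= !diracE; have [E0|E0] := pselect (E [tuple]).
    by rewrite !mem_set//= m0.
  by rewrite !memNset//= m0.
rewrite !pow_measureS big_ord_recl EFinM.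
pose h y := pow_measure mu2 n [set t | E (cons_pair (y, t))].
have mh : measurable_fun setT h by exact: measurable_pow_section.
have h0 y : 0 <= h y by exact: measure_ge0.
(* Slices over points outside [K] are empty, so both integrals reduce to [K], where the image of
   [mu1] under [f ord0] is [c ord0] times [mu2]. *)
have hK y : ~ K y -> h y = 0.
  move=> Ky; rewrite /h (_ : [set _ | _] = set0) ?measure0//.
  by apply/seteqP; split => // t /= /EK/(_ ord0); rewrite tnth0.
set C := (\prod_i (c (lift ord0 i))%:num)%R.
have C0 : (0 <= C)%R by exact: prodr_ge0.
transitivity (\int[mu1]_x (C%:E * h (f ord0 x))).
  apply: eq_integral => x _ /=.
  have [Kx|Kx] := pselect (K (f ord0 x)).
    rewrite /C /h -(IH (fun i => f (lift ord0 i)))//.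
    - congr (pow_measure _ _ _); apply/seteqP.
      by split=> t /=; rewrite /cons_pair /= map_coord_cons.
    - by move=> i F mF FK; exact: fE.
    - exact: measurable_cons_section.
    - by move=> t /= /EK Kt i; have := Kt (lift ord0 i); rewrite tnthS.
  rewrite hK// mule0 (_ : [set _ | _] = set0) ?measure0//.
  apply/seteqP; split => // t /=; rewrite /cons_pair /= map_coord_cons.
  by move=> /EK/(_ ord0); rewrite tnth0.
rewrite ge0_integralZl//; last first.
  by apply: measurableT_comp.
rewrite -muleA muleCA; congr (_ * _).
have mhK : measurable_fun K h by exact: measurable_funS mh.
transitivity (\int[mu1]_(x in f ord0 @^-1` K) h (f ord0 x)).
  rewrite [RHS]integral_mkcond; apply: eq_integral => x _.
  rewrite patchE; case: ifPn => //; rewrite notin_setE => Kx; exact: hK.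
have /= <- := @ge0_integral_pushforward _ _ _ _ _ _ (mf ord0) mu1 K h mK mhK
  (fun y _ => h0 y).
rewrite (eq_measure_integral (mscale (c ord0) mu2)); last first.
  by move=> A mA AK; exact: fE.
rewrite ge0_integral_mscale//; congr (_ * _).
rewrite integral_mkcond; apply: eq_integral => x _.
by rewrite patchE; case: ifPn => //; rewrite notin_setE => Kx; rewrite -/(h x) hK.
Qed.

Lemma pow_measure_prod d (T : measurableType d) (R : realType)
    (mu : {sigma_finite_measure set T -> \bar R}) n (K : 'I_n -> set T) :
  (forall i, measurable (K i)) ->
  pow_measure mu n [set t | forall i, K i (tnth t i)] = \prod_(i < n) mu (K i).
Proof.
elim: n K => [|n IH] K mK.
  by rewrite big_ord0 /= diracE mem_set//= => -[].
rewrite pow_measureS big_ord_recl.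
rewrite (eq_integral (fun x => (\1_(K ord0) x)%:E *
    \prod_(i < n) mu (K (lift ord0 i)))).
  rewrite ge0_integralZr ?integral_indic ?setIT//.
  - exact: measurableT_comp.
  - by apply: prode_ge0 => i _; exact: measure_ge0.
move=> x _; rewrite indicE.
have [Kx|Kx] := pselect (K ord0 x).
  rewrite mem_set// mul1e -IH//; congr (pow_measure _ _ _).
  apply/seteqP; split => t /= h i; first by have := h (lift ord0 i); rewrite tnthS.
  by case: (unliftP ord0 i) => [j ->|->]; rewrite /cons_pair ?tnthS ?tnth0.
rewrite memNset// mul0e (_ : [set _ | _] = set0) ?measure0//.
by apply/seteqP; split => // t /= /(_ ord0); rewrite tnth0.
Qed.

End pow_measure_theory.

(** * Uniqueness of Haar measure *)

Section linear_image.
Local Open Scope ereal_scope.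
Context d (G : measurableType d) (R : realType).
(** The group structure enters through subtraction only; [subKr] makes each reflection x |-> z - x
    an involution. *)
Variables (lam : {sigma_finite_measure set G -> \bar R}) (sub : G -> G -> G).
Hypothesis msub : measurable_fun setT (fun p : G * G => sub p.1 p.2).
Hypothesis subKr : forall z x, sub z (sub z x) = x.
Hypothesis lam_shift :
  forall a E, measurable E -> lam [set z | E (sub z a)] = lam E.
Hypothesis lam_reflect :
  forall a E, measurable E -> lam [set x | E (sub a x)] = lam E.
Variable T : G -> G.
Hypothesis mT : measurable_fun setT T.
Hypothesis T_sub : forall x y, T (sub x y) = sub (T x) (T y).
Hypothesis T_surj : forall z, exists y, T y = z.

(* The total mass of the convolution at z of E and F along T; the reflection of x
   exchanges the roles of E and F. *)
Let conv E F := (lam \x lam) [set p | E (T p.1) /\ F (sub p.2 (T p.1))].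

Let mconv E F : measurable E -> measurable F ->
  measurable [set p : G * G | E (T p.1) /\ F (sub p.2 (T p.1))].
Proof.
move=> mE mF; apply: measurableI.
  apply: (measurable_preimT _ mE); apply: measurableT_comp => //.
apply: (measurable_preimT _ mF).
have mg : measurable_fun setT (fun p : G * G => (p.2, T p.1)).
  by apply: measurable_fun_pair => //; apply: measurableT_comp.
exact: (measurableT_comp msub mg).
Qed.

Let convE E F : measurable E -> measurable F ->
  conv E F = lam (T @^-1` E) * lam F.
Proof.
move=> mE mF; rewrite /conv /= /product_measure1.
have mTE : measurable (T @^-1` E) by apply: measurable_preimT mE.
rewrite (eq_integral (fun x => (\1_(T @^-1` E) x)%:E * lam F)).
  rewrite ge0_integralZr ?integral_indic ?setIT//.
  exact: measurableT_comp.
move=> x _; rewrite indicE /=; have [Ex|Ex] := pselect (E (T x)).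
  rewrite mem_set// mul1e -(lam_shift (T x) mF); congr (lam _).
  apply/seteqP; split => z; rewrite /xsection /= inE /=; first by case.
  by [].
rewrite memNset// mul0e (_ : xsection _ _ = set0) ?measure0//.
by apply/seteqP; split => // z; rewrite /xsection /= inE /= => -[].
Qed.

Let conv_sym E F : measurable E -> measurable F -> conv E F = conv F E.
Proof.
move=> mE mF; rewrite /conv.
(* The order of integration is switched: for a fixed second variable z, the conditions on x read E
   (T x) and F (z - T x). *)
rewrite (product_measure_unique (m' := (lam \x^ lam)%E)); last 2 first.
- by move=> * /=; rewrite product_measure2E.
- exact: mconv.
rewrite (product_measure_unique (m' := (lam \x^ lam)%E)); last 2 first.
- by move=> * /=; rewrite product_measure2E.
- exact: mconv.
rewrite /= /product_measure2; apply: eq_integral => z _ /=.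
(* Since z = T y, the reflection x |-> y - x turns T x into z - T x and thus swaps the two
   conditions. *)
have [y yz] := T_surj z.
set A := ysection _ z.
have mA : measurable A by apply: measurable_ysection; exact: mconv.
rewrite -(lam_reflect y mA); congr (lam _); apply/seteqP.
split => x; rewrite /A /ysection /= !inE /= T_sub yz subKr; tauto.
Qed.

(** Both sides are convolution masses, with [E] and [F] exchanged. When [lam E] is 1, this says that
    the image of [lam] under [T] is a multiple of [lam]. *)
Lemma linear_image_measure E F : measurable E -> measurable F ->
  lam (T @^-1` E) * lam F = lam E * lam (T @^-1` F).
Proof. by move=> mE mF; rewrite -convE// conv_sym// convE// muleC. Qed.

End linear_image.

(** * Affine maps of the line *)

Section lebesgue_line.
Context (R : realType).
Notation RT := (measurableTypeR R).
Notation leb := (@lebesgue_measure R).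
Local Open Scope ereal_scope.

(** Lebesgue measure is determined by half-open intervals, on which [a] times the image measure is
    computed. *)
Lemma lebesgue_affine (a b : R) (E : set RT) : (0 < a)%R -> measurable E ->
  leb [set x | E (a * x + b)%R] = (a^-1)%:E * leb E.
Proof.
move=> a0 mE.
have mf : measurable_fun setT ((fun x => a * x + b)%R : RT -> RT).
  by apply: measurable_funD => //; exact: measurable_funM.
pose m : {measure set RT -> \bar R} := mscale (NngNum (ltW a0))
  (measure_function_pushforward__canonical__measure_function_Measure leb mf).
suff mX : forall X, ocitv X -> leb X = m X.
  rewrite (lebesgue_measure_unique mX mE) /m /= /mscale /=.
  by rewrite muleA -EFinM mulVf ?gt_eqF// mul1e.
move=> _ [[u v]] _ <-; rewrite /m /= /mscale /= /pushforward.
rewrite (_ : _ @^-1` _ = `](u - b) / a, (v - b) / a]%classic)%R; last first.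
  apply/seteqP; split => x; rewrite /= !in_itv /=;
  by rewrite ltr_pdivrMr// ler_pdivlMr// ltrBlDr lerBrDr mulrC.
rewrite !lebesgue_measure_itv /= !lte_fin ltr_pM2r ?invr_gt0// ltrD2r.
case: ifP => _; last by rewrite mule0.
rewrite -!EFinD -EFinM; congr (_%:E).
by rewrite -mulrBl mulrC mulfVK ?gt_eqF//; ring.
Qed.

Lemma lebesgue_shift (a : R) (E : set RT) : measurable E ->
  leb [set z | E (z - a)%R] = leb E.
Proof.
move=> mE; rewrite -[RHS]mul1e -[X in X%:E]invr1 -(lebesgue_affine (- a))//.
by congr (lebesgue_measure _); apply/seteqP; split => x /=; rewrite mul1r.
Qed.

Lemma lebesgue_reflect (a : R) (E : set RT) : measurable E ->
  leb [set z | E (a - z)%R] = leb E.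
Proof.
move=> mE; rewrite -[RHS]lebesgue_measureN//.
have mN : measurable [set x : RT | E (- x)%R].
  by apply: (measurable_preimT _ mE); exact: measurable_funN.
rewrite -[RHS](lebesgue_shift a mN).
by congr (lebesgue_measure _); apply/seteqP; split => x /=; rewrite opprB.
Qed.

Lemma lebesgue_scale (a : R) (E : set RT) : (0 < a)%R -> measurable E ->
  leb [set x | E (a * x)%R] = (a^-1)%:E * leb E.
Proof.
move=> a0 mE; rewrite -(lebesgue_affine 0 a0)//.
by congr (lebesgue_measure _); apply/seteqP; split => x /=; rewrite addr0.
Qed.

End lebesgue_line.

Lemma muleVK (R : realType) (c : R) (x : \bar R) : c != 0 ->
  ((c^-1)%:E * (c%:E * x) = x)%E.
Proof. by move=> c0; rewrite muleA -EFinM mulVf// mul1e. Qed.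

Lemma muleVKr (R : realType) (c : R) (x : \bar R) : c != 0 ->
  (c%:E * ((c^-1)%:E * x) = x)%E.
Proof. by move=> c0; rewrite muleA -EFinM mulfV// mul1e. Qed.

(** Product measures are determined by rectangles, on which the rescaled image measure [m']
    factors. *)
Lemma product_measure_map d1 d2 d1' d2' (T1 : measurableType d1)
    (T2 : measurableType d2) (T1' : measurableType d1')
    (T2' : measurableType d2') (R : realType)
    (m1 : {sigma_finite_measure set T1 -> \bar R})
    (m2 : {sigma_finite_measure set T2 -> \bar R})
    (m1' : {sigma_finite_measure set T1' -> \bar R})
    (m2' : {sigma_finite_measure set T2' -> \bar R})
    (f : T1 -> T1') (g : T2 -> T2') (a b : R) :
  measurable_fun setT f -> measurable_fun setT g -> 0 < a -> 0 < b ->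
  (forall E, measurable E -> m1 (f @^-1` E) = a%:E * m1' E)%E ->
  (forall E, measurable E -> m2 (g @^-1` E) = b%:E * m2' E)%E ->
  forall E, measurable E ->
  ((m1 \x m2) [set p | E (f p.1, g p.2)] = (a * b)%:E * (m1' \x m2') E)%E.
Proof.
move=> mf mg a0 b0 fE gE E mE.
have mh : measurable_fun setT (fun p => (f p.1, g p.2)).
  by apply: measurable_fun_pair; apply: measurableT_comp.
have ab0 : a * b != 0 by rewrite mulf_neq0// gt_eqF.
have c0 : 0 <= (a * b)^-1 by rewrite invr_ge0 ltW// mulr_gt0.
pose m' : {measure set (T1' * T2') -> \bar R} := mscale (NngNum c0)
  (measure_function_pushforward__canonical__measure_function_Measure
    (m1 \x m2)%E mh).
rewrite (product_measure_unique (m' := m'))//.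
  by rewrite /m' /= /mscale /= muleVKr.
move=> A B mA mB; rewrite /m' /= /mscale /= /pushforward.
rewrite (_ : _ @^-1` _ = (f @^-1` A) `*` (g @^-1` B)); last first.
  by apply/seteqP; split.
rewrite product_measure1E; last 2 first.
- by apply: measurable_preimT mA.
- by apply: measurable_preimT mB.
rewrite [X in (_ * (X * _))%E](fE _ mA) [X in (_ * (_ * X))%E](gE _ mB).
rewrite muleACA; exact: (muleVK _ ab0).
Qed.

(** * Invariant measures on powers of a group *)

Section tuple_group.
Local Open Scope ereal_scope.
Context d (T : measurableType d) (R : realType).
Variables (mu : {sigma_finite_measure set T -> \bar R}) (sub : T -> T -> T).
Hypothesis msub : measurable_fun setT (fun p : T * T => sub p.1 p.2).
Hypothesis subKr : forall z x, sub z (sub z x) = x.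
Hypothesis mu_shift :
  forall a E, measurable E -> mu [set z | E (sub z a)] = mu E.
Hypothesis mu_reflect :
  forall a E, measurable E -> mu [set x | E (sub a x)] = mu E.
Variables (K : set T) (mK : measurable K) (muK : mu K = 1).

Definition tuple_sub n (s t : n.-tuple T) : n.-tuple T :=
  [tuple sub (tnth s i) (tnth t i) | i < n].

Let msubr a : measurable_fun setT (sub ^~ a).
Proof.
have mp : measurable_fun setT (fun x : T => (x, a)).
  by apply: measurable_fun_pair => //; exact: measurable_cst.
exact: (measurableT_comp msub mp).
Qed.

Let msubl a : measurable_fun setT (sub a).
Proof.
have mp : measurable_fun setT (fun x : T => (a, x)).
  by apply: measurable_fun_pair => //; exact: measurable_cst.
exact: (measurableT_comp msub mp).
Qed.

Let mtuple_sub n : measurable_fun setT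
  (fun p : n.-tuple T * n.-tuple T => tuple_sub p.1 p.2).
Proof.
apply/measurable_fun_tnthP => i.
rewrite (_ : _ \o _ = fun p => sub (tnth p.1 i) (tnth p.2 i)); last first.
  by apply/funext => p /=; rewrite tnth_mktuple.
have mp : measurable_fun setT
    (fun p : n.-tuple T * n.-tuple T => (tnth p.1 i, tnth p.2 i)).
  apply: measurable_fun_pair.
    exact: (measurableT_comp (measurable_tnth i) measurable_fst).
  exact: (measurableT_comp (measurable_tnth i) measurable_snd).
exact: (measurableT_comp msub mp).
Qed.

Let unit_pow_map n (f : 'I_n -> T -> T) E :
  (forall i, measurable_fun setT (f i)) ->
  (forall i F, measurable F -> mu (f i @^-1` F) = mu F) ->
  measurable E -> pow_measure mu n (map_coord f @^-1` E) = pow_measure mu n E.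
Proof.
move=> mf fE mE.
rewrite (@pow_measure_map _ _ _ _ _ mu mu setT n f (fun=> 1%:nng)%R)//.
  by rewrite big1// mul1e.
by move=> i F mF _; rewrite mul1e; exact: fE.
Qed.

(** The box over [K] has mass one, so in [linear_image_measure] it isolates the constant, which is
    the mass of its preimage under [S]. *)
Lemma pow_measure_linear_image n (S : n.-tuple T -> n.-tuple T) :
  measurable_fun setT S ->
  (forall s t, S (tuple_sub s t) = tuple_sub (S s) (S t)) ->
  (forall z, exists y, S y = z) ->
  forall F, measurable F -> pow_measure mu n (S @^-1` F) =
    pow_measure mu n (S @^-1` @box _ _ n K) * pow_measure mu n F.
Proof.
move=> mS S_sub S_surj F mF.
rewrite (@linear_image_measure _ _ _ (pow_measure mu n) (@tuple_sub n))//.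
- have -> : pow_measure mu n (@box _ _ n K) = 1.
    by rewrite (@pow_measure_prod _ _ _ mu n (fun=> K))// big1.
  by rewrite mul1e.
- exact: mtuple_sub.
- move=> z x; apply: eq_from_tnth => i.
  by rewrite !tnth_mktuple subKr.
- move=> a E mE; rewrite -[RHS](@unit_pow_map _ (fun i z => sub z (tnth a i)))//.
  by move=> i G mG; exact: mu_shift.
- move=> a E mE; rewrite -[RHS](@unit_pow_map _ (fun i => sub (tnth a i)))//.
  by move=> i G mG; exact: mu_reflect.
- exact: measurable_box.
Qed.

End tuple_group.

Section real_tuples.
Context (R : realType).
Local Notation RT := (measurableTypeR R).
Local Notation leb := (@lebesgue_measure R).

Definition mulmx_tuple n m (L : 'M[R]_(n, m)) (t : n.-tuple RT) : m.-tuple RT :=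
  [tuple ((\row_i tnth t i) *m L) 0 j | j < m].

Lemma tnth_mulmx_tuple n m (L : 'M[R]_(n, m)) t j :
  tnth (mulmx_tuple L t) j = \sum_i tnth t i * L i j.
Proof.
by rewrite tnth_mktuple mxE; apply: eq_bigr => i _; rewrite mxE.
Qed.

Lemma row_mulmx_tuple n m (L : 'M[R]_(n, m)) t :
  \row_j tnth (mulmx_tuple L t) j = (\row_i tnth t i) *m L.
Proof. by apply/rowP => j; rewrite mxE tnth_mktuple. Qed.

Lemma measurable_mulmx_tuple n m (L : 'M[R]_(n, m)) :
  measurable_fun setT (mulmx_tuple L).
Proof.
apply/measurable_fun_tnthP => j.
rewrite (_ : _ \o _ = fun t => \sum_i tnth t i * L i j); last first.
  by apply/funext => t /=; rewrite tnth_mulmx_tuple.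
apply: measurable_sum => i; apply: measurable_funM; first exact: measurable_tnth.
exact: measurable_cst.
Qed.

Lemma lebesgue_unit_itv : leb `[0, 1]%classic = 1%E.
Proof. by rewrite lebesgue_measure_itv /= lte_fin ltr01 -EFinD subr0. Qed.

(* The constant is the inverse of |det L|, but its value is never needed. *)
Lemma pow_lebesgue_mulmx n (L : 'M[R]_n) : L \in unitmx ->
  exists2 c : \bar R, (0 <= c)%E & forall F, measurable F ->
    pow_measure leb n (mulmx_tuple L @^-1` F) = (c * pow_measure leb n F)%E.
Proof.
move=> uL.
exists (pow_measure leb n (mulmx_tuple L @^-1` @box _ RT n `[0%R, 1%R]%classic)).
  exact: measure_ge0.
apply: (@pow_measure_linear_image _ _ _ _ (fun x y : RT => x - y)) => //.
- exact: measurable_funB.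
- by move=> z x; rewrite opprB addrCA subrr addr0.
- exact: lebesgue_shift.
- exact: lebesgue_reflect.
- exact: lebesgue_unit_itv.
- exact: measurable_mulmx_tuple.
- move=> s t; apply: eq_from_tnth => j.
  rewrite [RHS]tnth_mktuple !tnth_mulmx_tuple -sumrB; apply: eq_bigr => i _.
  by rewrite tnth_mktuple mulrBl.
- move=> z; exists (mulmx_tuple (invmx L) z); apply: eq_from_tnth => j.
  by rewrite tnth_mktuple row_mulmx_tuple -mulmxA mulVmx// mulmx1 mxE.
Qed.

Lemma pow_lebesgue_scale n (r : R) (F : set (n.-tuple RT)) : 0 < r ->
  measurable F ->
  pow_measure leb n (map_coord (fun=> *%R r) @^-1` F) =
  ((r^-1 ^+ n)%:E * pow_measure leb n F)%E.
Proof.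
move=> r0 mF; have ri0 : 0 <= r^-1 by rewrite invr_ge0 ltW.
rewrite (@pow_measure_map _ _ _ _ _ leb leb setT n _ (fun=> NngNum ri0))//.
- by rewrite big_const_ord iter_mulr_1.
- by move=> i E mE _; exact: lebesgue_scale.
Qed.

End real_tuples.

(** * Lebesgue measure of the plane *)

Section planar_tuples.
Context (R : realType).
Local Notation RT := (measurableTypeR R).
Local Notation RR := (measurableTypeR R * measurableTypeR R)%type.
Local Notation leb := (@lebesgue_measure R).

Lemma planar_map (f g : RT -> RT) a b (E : set RR) :
  measurable_fun setT f -> measurable_fun setT g -> 0 < a -> 0 < b ->
  (forall E, measurable E -> leb (f @^-1` E) = a%:E * leb E)%E ->
  (forall E, measurable E -> leb (g @^-1` E) = b%:E * leb E)%E ->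
  measurable E ->
  planar_lebesgue [set p | E (f p.1, g p.2)] =
    ((a * b)%:E * planar_lebesgue E)%E.
Proof.
move=> mf mg a0 b0 fE gE mE.
by rewrite /planar_lebesgue (product_measure_map _ _ a0 b0 fE gE).
Qed.

Definition planar_sub (p q : RR) : RR := (p.1 - q.1, p.2 - q.2).

Lemma planar_shift (a : RR) (E : set RR) : measurable E ->
  planar_lebesgue [set z | E (planar_sub z a)] = planar_lebesgue E.
Proof.
move=> mE; rewrite -[RHS]mul1e -[1%E]/((1%R)%:E) -[X in X%:E]mulr1.
rewrite -(@planar_map (fun x => x - a.1) (fun x => x - a.2))//.
- exact: measurable_funB.
- exact: measurable_funB.
- by move=> F mF; rewrite mul1e; exact: lebesgue_shift.
- by move=> F mF; rewrite mul1e; exact: lebesgue_shift.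
Qed.

Lemma planar_reflect (a : RR) (E : set RR) : measurable E ->
  planar_lebesgue [set z | E (planar_sub a z)] = planar_lebesgue E.
Proof.
move=> mE; rewrite -[RHS]mul1e -[1%E]/((1%R)%:E) -[X in X%:E]mulr1.
rewrite -(@planar_map (fun x => a.1 - x) (fun x => a.2 - x))//.
- exact: measurable_funB.
- exact: measurable_funB.
- by move=> F mF; rewrite mul1e; exact: lebesgue_reflect.
- by move=> F mF; rewrite mul1e; exact: lebesgue_reflect.
Qed.

Lemma planar_scale (r : R) (E : set RR) : 0 < r -> measurable E ->
  planar_lebesgue [set p | E (r * p.1, r * p.2)] =
  ((r^-1 ^+ 2)%:E * planar_lebesgue E)%E.
Proof.
move=> r0 mE.
rewrite expr2 -(@planar_map ( *%R r) ( *%R r)) ?invr_gt0//.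
- by move=> F mF; exact: lebesgue_scale.
- by move=> F mF; exact: lebesgue_scale.
Qed.

End planar_tuples.

(** * Lebesgue measure on C^n *)

Section complex_tuples.
Context (R : realType).
Local Notation RT := (measurableTypeR R).
Local Notation RR := (measurableTypeR R * measurableTypeR R)%type.
Local Open Scope complex_scope.

Lemma to_planeK (z : R[i]) : of_plane (to_plane z) = z.
Proof. by case: z. Qed.

Lemma of_planeK (p : R * R) : to_plane (of_plane p) = p.
Proof. by case: p. Qed.

Lemma of_planeB (p q : R * R) :
  of_plane (planar_sub p q) = of_plane p - of_plane q.
Proof. by case: p => a b; case: q => c d. Qed.

Definition mulmx_planes n (U : 'M[R[i]]_n) (t : n.-tuple RR) : n.-tuple RR :=
  [tuple to_plane ((U *m of_planes t) i 0) | i < n].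

Lemma of_planes_mulmx n (U : 'M[R[i]]_n) t :
  of_planes (mulmx_planes U t) = U *m of_planes t.
Proof.
by apply/matrixP => i j; rewrite mxE tnth_mktuple to_planeK (ord1 j).
Qed.

Lemma of_planes_inj n : injective (@of_planes R n).
Proof.
move=> s t /matrixP st; apply: eq_from_tnth => i.
by have := st i 0; rewrite !mxE => /(congr1 (@to_plane R)); rewrite !of_planeK.
Qed.

Lemma measurable_mulmx_planes n (U : 'M[R[i]]_n) :
  measurable_fun setT (mulmx_planes U).
Proof.
apply/measurable_fun_tnthP => i.
pose g (t : n.-tuple RR) := \sum_j (U i j * of_plane (tnth t j)).
have gE t : (U *m of_planes t) i 0 = g t.
  by rewrite mxE; apply: eq_bigr => j _; rewrite mxE.
have [g1 g2] : cmeasurable g.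
  apply: cmeasurable_sum => j; apply: cmeasurableM.
    by split; exact: measurable_cst.
  exact: cmeasurable_coord.
rewrite (_ : _ \o _ = fun t => (complex.Re (g t), complex.Im (g t))).
  exact: measurable_fun_pair.
by apply/funext => t; rewrite /= tnth_mktuple gE.
Qed.

Lemma planar_unit_square :
  planar_lebesgue (`[0%R, 1%R]%classic `*` `[0%R, 1%R]%classic : set RR) = 1%E.
Proof.
rewrite /planar_lebesgue product_measure1E; last 2 first.
- exact: measurable_itv.
- exact: measurable_itv.
by rewrite [X in (X * _)%E]lebesgue_unit_itv mul1e; exact: lebesgue_unit_itv.
Qed.

(** A complex linear bijection is additive on (R^2)^n, so the uniqueness argument applies; the
    constant is |det U|^-2. *)
Lemma pow_planar_mulmx n (U : 'M[R[i]]_n) : U \in unitmx ->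
  exists2 c : \bar R, (0 <= c)%E & forall F, measurable F ->
    pow_measure (@planar_lebesgue R) n (mulmx_planes U @^-1` F) =
    (c * pow_measure (@planar_lebesgue R) n F)%E.
Proof.
move=> uU.
exists (pow_measure (@planar_lebesgue R) n (mulmx_planes U @^-1`
    @box _ RR n (`[0%R, 1%R]%classic `*` `[0%R, 1%R]%classic))).
  exact: measure_ge0.
have mI : measurable (`[0%R, 1%R]%classic : set RT) by exact: measurable_itv.
apply: (@pow_measure_linear_image _ _ _ _ (@planar_sub R)) => //.
- apply: measurable_fun_pair; apply: measurable_funB.
  + exact: (measurableT_comp measurable_fst measurable_fst).
  + exact: (measurableT_comp measurable_fst measurable_snd).
  + exact: (measurableT_comp measurable_snd measurable_fst).
  + exact: (measurableT_comp measurable_snd measurable_snd).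
- by move=> [z1 z2] [x1 x2]; congr pair => /=; rewrite opprB addrCA subrr addr0.
- exact: planar_shift.
- exact: planar_reflect.
- exact: measurableX.
- exact: planar_unit_square.
- exact: measurable_mulmx_planes.
- move=> s t; apply: of_planes_inj.
  have subE (s' t' : n.-tuple RR) : of_planes (tuple_sub (@planar_sub R) s' t') =
      of_planes s' - of_planes t'.
    by apply/matrixP => i j; rewrite !mxE tnth_mktuple of_planeB.
  by rewrite subE !of_planes_mulmx subE mulmxBr.
- move=> z; exists (mulmx_planes (invmx U) z); apply: of_planes_inj.
  by rewrite !of_planes_mulmx mulmxA mulmxV// mul1mx.
Qed.

(** * The squared modulus in the plane *)

Definition plane_normsq (p : R * R) : R := p.1 ^+ 2 + p.2 ^+ 2.

Lemma measurable_plane_normsq :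
  measurable_fun setT (plane_normsq : RR -> RT).
Proof.
apply: measurable_funD; apply: measurable_funX.
  exact: measurable_fst.
exact: measurable_snd.
Qed.

Local Notation leb := (@lebesgue_measure R).
Local Open Scope ereal_scope.

Let m : {measure set RT -> \bar R} :=
  (measure_function_pushforward__canonical__measure_function_Measure
    (@planar_lebesgue R) measurable_plane_normsq).
Let mE X : m X = planar_lebesgue (plane_normsq @^-1` X).
Proof. by []. Qed.

Let D := [set p : RR | plane_normsq p <= 1]%R.
Let c := fine (planar_lebesgue D).

Let mD : measurable D.
Proof.
rewrite (_ : D = [set p : RR | `]-oo, 1%R]%classic (plane_normsq p)]).
  apply: (measurable_preimT measurable_plane_normsq); exact: measurable_itv.
by apply/seteqP; split => p /=; rewrite in_itv.
Qed.

Let square (a b : R) := (`[a, b]%classic `*` `[a, b]%classic : set RR).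

Let msquare a b : measurable (square a b).
Proof. by apply: measurableX; exact: measurable_itv. Qed.

Let squareE a b : (a < b)%R -> planar_lebesgue (square a b) = ((b - a) * (b - a))%:E.
Proof.
move=> ab; rewrite /planar_lebesgue product_measure1E; last 2 first.
- exact: measurable_itv.
- exact: measurable_itv.
have E : leb `[a, b]%classic = (b - a)%:E.
  by rewrite lebesgue_measure_itv /= lte_fin ab.
by rewrite [X in (X * _)%E]E [X in (_ * X)%E]E.
Qed.

Let D_fin : planar_lebesgue D \is a fin_num.
Proof.
rewrite ge0_fin_numE; last exact: measure_ge0.
apply: (@le_lt_trans _ _ (planar_lebesgue (square (-1) 1))).
  apply: le_measure; rewrite ?inE//.
  move=> p; rewrite /D /plane_normsq /= => p1.
  by split; rewrite /= in_itv /= -ler_norml -(@expr_le1 _ 2)//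
    real_normK ?num_real//; nra.
by rewrite squareE ?ltry//; lra.
Qed.

Let c_gt0 : (0 < c)%R.
Proof.
rewrite -lte_fin fineK//.
apply: (@lt_le_trans _ _ (planar_lebesgue (square 0 2^-1))).
  by rewrite squareE ?lte_fin//; lra.
apply: le_measure; rewrite ?inE//.
move=> [x y] [] /=; rewrite /D /plane_normsq !in_itv /= => /andP[x0 x1] /andP[y0 y1].
by nra.
Qed.

(** The disc of squared radius [r] is the dilate of the unit disc by the square root of [r]; for r =
    0 it is a null point. *)
Let disc (r : R) : (0 <= r)%R -> m `]-oo, r]%classic = (c * r)%:E.
Proof.
rewrite le_eqVlt => /predU1P[<-|r0]; last first.
  have s0 : (0 < Num.sqrt r)%R by rewrite sqrtr_gt0.
  have si0 : (0 < (Num.sqrt r)^-1)%R by rewrite invr_gt0.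
  rewrite mE (_ : _ @^-1` _ =
     [set p : RR | D ((Num.sqrt r)^-1 * p.1, (Num.sqrt r)^-1 * p.2)%R]).
    rewrite planar_scale// invrK sqr_sqrtr ?(ltW r0)// mulrC EFinM fineK//.
  apply/seteqP; split => p; rewrite /D /plane_normsq /= in_itv /= !exprMn exprVn;
    by rewrite sqr_sqrtr ?(ltW r0)// -mulrDr ler_pdivrMl// mulr1.
rewrite mulr0 mE.
have ms0 : measurable ([set 0%R] : set RT) by exact: measurable_set1.
have Z : planar_lebesgue ([set 0%R] `*` [set 0%R] : set RR) = 0.
  rewrite /planar_lebesgue product_measure1E//.
  by rewrite [X in (X * _)%E]lebesgue_measure_set1 mul0e.
apply: (subset_measure0 _ _ _ Z).
- apply: (measurable_preimT measurable_plane_normsq); exact: measurable_itv.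
- exact: measurableX.
move=> [x y]; rewrite /plane_normsq /= in_itv /= => xy.
have x2 := sqr_ge0 x; have y2 := sqr_ge0 y.
by split; apply/eqP; rewrite /= -sqrf_eq0 eq_le ?x2 ?y2 andbT; lra.
Qed.

Let mneg : measurable (`]-oo, 0%R]%classic : set RT).
Proof. exact: measurable_itv. Qed.

(* Polar coordinates in the plane; the constant is pi, but this is never needed. *)
Lemma planar_normsq : exists c : {nonneg R}, forall E : set RT,
  measurable E -> E `<=` `[0%R, +oo[%classic ->
  planar_lebesgue (plane_normsq @^-1` E) = c%:num%:E * leb E.
Proof.
exists (NngNum (ltW c_gt0)) => E mS E0 /=.
have ci0 : (0 <= c^-1)%R by rewrite invr_ge0 ltW.
have cn0 : (c != 0)%R by rewrite gt_eqF.
(* Uniqueness of Lebesgue measure concerns the whole line, so [m1], which is carried by the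
   nonnegative half-line, is completed by Lebesgue measure on the other half. *)
pose m1 : {measure set RT -> \bar R} := mscale (NngNum ci0) m.
pose m2 : {measure set RT -> \bar R} := mrestr leb mneg.
have m0 (X : set RT) : X `<=` `]-oo, 0%R]%classic -> measurable X -> m X = 0.
  move=> X0 mX; apply: (subset_measure0 mX mneg X0).
  by have := disc (lexx 0%R); rewrite mulr0.
have addE (X : set RT) : measure_add m1 m2 X =
    (c^-1)%:E * m X + leb (X `&` `]-oo, 0%R]).
  exact: measure_addE.
suff mX : forall X, ocitv X -> leb X = measure_add m1 m2 X.
  have -> : leb E = measure_add m1 m2 E by exact: (lebesgue_measure_unique mX mS).
  rewrite addE (_ : leb (_ `&` _) = 0) ?adde0 ?muleVKr//.
  have ms0 : measurable ([set 0%R] : set RT) by exact: measurable_set1.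
  apply: (subset_measure0 (measurableI _ _ mS mneg) ms0).
    move=> x [/E0 /=]; rewrite !in_itv /= andbT => x0 x1.
    by apply/eqP; rewrite eq_le x0 x1.
  exact: lebesgue_measure_set1.
move=> _ [[a b]] _ <-; rewrite addE.
have [ab|ba] := ltP a b; last first.
  rewrite set_itv_ge ?bnd_simp -?leNgt// set0I !measure0.
  exact: (esym (etrans (adde0 _) (mule0 _))).
rewrite [LHS]lebesgue_measure_itv /= lte_fin ab -EFinD.
have moc (u v : R) : measurable (`]u, v]%classic : set RT) by exact: measurable_itv.
(* For 0 <= a the preimage is an annulus, a difference of two discs; the other cases are b <= 0 and
   a < 0 < b. *)
have [a0|a0] := leP 0%R a.
  rewrite (_ : `]a, b] `&` _ = set0); last first.
    by apply/seteqP; split => // x /=; rewrite !in_itv /= => -[/andP[ax _] x0]; lra.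
  rewrite measure0 adde0.
  rewrite (_ : `]a, b]%classic = `]-oo, b]%classic `\` `]-oo, a]%classic); last first.
    apply/seteqP; split => x /=; rewrite !in_itv /=.
      by move=> /andP[ax ->]; split => //; apply/negP; rewrite -ltNge.
    by move=> [-> /negP]; rewrite -ltNge => ->.
  have mc (u : R) : measurable (`]-oo, u]%classic : set RT).
    exact: measurable_itv.
  have b0 : (0 <= b)%R by rewrite (le_trans a0)// ltW.
  have mb : m `]-oo, b]%classic < +oo by rewrite disc// ltry.
  rewrite (measureD (mc b) (mc a) mb).
  rewrite (_ : `]-oo, b] `&` `]-oo, a] = `]-oo, a]%classic); last first.
    apply/seteqP; split => x /=; rewrite !in_itv /=; first by case.
    by move=> xa; split => //; rewrite (le_trans xa)// ltW.
  by rewrite [X in (_ * (X - _))%E]disc// [X in (_ * (_ - X))%E]disc// -EFinD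
    -EFinM -mulrBr mulKf.
have [b0|b0] := leP b 0%R.
  rewrite [X in (_ * X)%E]m0//; last first.
    by move=> x /=; rewrite !in_itv /= => /andP[_ xb]; lra.
  rewrite mule0 add0e (_ : `]a, b] `&` _ = `]a, b]%classic); last first.
    apply/seteqP; split => x /=; rewrite !in_itv /=; first by case.
    by move=> /[dup] /andP[_ xb] ->; split => //; lra.
  by rewrite [RHS]lebesgue_measure_itv /= lte_fin ab -EFinD.
rewrite (_ : m _ = m `]-oo, b]%classic).
  rewrite disc ?ltW// -EFinM mulKf//.
  rewrite (_ : `]a, b] `&` _ = `]a, 0%R]%classic); last first.
    apply/seteqP; split => x /=; rewrite !in_itv /=.
      by move=> [/andP[-> _] ->].
    by move=> /andP[-> x0]; split => //=; lra.
  by rewrite [X in (_ + X)%E]lebesgue_measure_itv /= lte_fin a0 -!EFinD sub0r.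
rewrite !mE; congr (planar_lebesgue _); apply/seteqP.
split => p /=; rewrite !in_itv /=; first by case/andP.
move=> ->; rewrite andbT (lt_le_trans a0)// /plane_normsq addr_ge0 ?sqr_ge0//.
Qed.

End complex_tuples.

(** * Cones and hyperplanes *)

Section lebesgue_tuples.
Context (R : realType).
Local Notation RT := (measurableTypeR R).
Local Notation leb := (@lebesgue_measure R).

(** The slice of the cone at height r is the dilate r F, whose measure is r^m times that of F. *)
Lemma pow_lebesgue_cone m (F : set (m.-tuple RT)) : measurable F ->
  (pow_measure leb m.+1 [set t : m.+1.-tuple RT |
     (0 < thead t <= 1)%R /\
     F (map_coord (fun=> *%R (thead t : R)^-1) [tuple of behead t])] =
   \int[leb]_(r in `]0%R, 1%R]) (r ^+ m)%:E * pow_measure leb m F)%E.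
Proof.
move=> mF; rewrite pow_measureS.
have mI : measurable (`]0%R, 1%R]%classic : set RT) by exact: measurable_itv.
have mX : measurable_fun (`]0%R, 1%R]%classic : set RT)
    (fun r : RT => (r ^+ m)%:E).
  apply/measurable_EFinP; apply: measurable_funX; exact: measurable_id.
rewrite -ge0_integralZr//; last first.
  move=> r /=; rewrite in_itv /= => /andP[r0 _].
  by rewrite lee_fin exprn_ge0// ltW.
rewrite [RHS]integral_mkcond; apply: eq_integral => r _.
rewrite patchE; case: ifPn; rewrite ?inE ?notin_setE /= in_itv /=.
  move=> /andP[r0 r1]; have ri0 : 0 < r^-1 by rewrite invr_gt0.
  rewrite -[r in RHS]invrK -(pow_lebesgue_scale ri0 mF).
  congr (pow_measure _ _ _); apply/seteqP; split => t /=.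
    move=> [_]; rewrite theadE; congr F; congr map_coord.
    by apply/val_inj.
  rewrite theadE r0 r1 => Ft; split => //; move: Ft; congr F; congr map_coord.
  by apply/val_inj.
move=> r01; rewrite (_ : [set _ | _] = set0) ?measure0//.
by apply/seteqP; split => // t /= [].
Qed.

(** No measurability is assumed: the integral of a nonnegative function is a supremum over the
    simple functions below it. *)
Lemma le_integral_ge0 d (T : measurableType d) (mu : {measure set T -> \bar R})
    (f g : T -> \bar R) : (forall x, 0 <= f x)%E -> (forall x, f x <= g x)%E ->
  (\int[mu]_x f x <= \int[mu]_x g x)%E.
Proof.
move=> f0 fg; have g0 x : (0 <= g x)%E by exact: le_trans (f0 x) (fg x).
rewrite !ge0_integralTE//; apply: le_ereal_sup => _ [h hf <-].
by exists h => // x; exact: le_trans (hf x) (fg x).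
Qed.

(** Stated for arbitrary sets, to be applied to degenerate convex hulls, which
    [measurable_conv_hull] does not cover. *)
Lemma le_pow_lebesgue n (A B : set (n.-tuple RT)) : A `<=` B ->
  (pow_measure leb n A <= pow_measure leb n B)%E.
Proof.
elim: n A B => [|n IH] A B AB.
  rewrite /= !diracE lee_fin ler_nat; case: (boolP (_ \in A)) => //.
  by rewrite inE => /AB Bt; rewrite mem_set.
rewrite !pow_measureS; apply: le_integral_ge0 => x; first exact: measure_ge0.
by apply: IH => t /AB.
Qed.

(** The linear bijection [L] replaces coordinate [i] by the form with coefficients [u]. The
    hyperplane is thus the preimage of the set where coordinate [i] equals -a, a product with a null
    factor. *)
Lemma pow_lebesgue_hyperplane n (a : R) (u : 'I_n -> R) (i : 'I_n) : u i != 0 ->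
  pow_measure leb n [set t | a + \sum_j tnth t j * u j = 0] = 0%E.
Proof.
move=> ui0; pose L : 'M[R]_n := \matrix_(k, j) if j == i then u k else (k == j)%:R.
have LE (x : 'rV[R]_n) j : (x *m L) 0 j =
    if j == i then \sum_k x 0 k * u k else x 0 j.
  rewrite mxE; have [->|ji] := eqVneq j i.
    by apply: eq_bigr => k _; rewrite mxE eqxx.
  rewrite (bigD1 j)//= big1 ?addr0; last first.
    by move=> k kj; rewrite mxE (negbTE ji) (negbTE kj) mulr0.
  by rewrite mxE (negbTE ji) eqxx mulr1.
have uL : L \in unitmx.
  rewrite -row_free_unit; apply: inj_row_free => x /rowP xL0.
  have x0 j : j != i -> x 0 j = 0.
    by move=> ji; have := xL0 j; rewrite LE (negbTE ji) mxE.
  apply/rowP => j; rewrite mxE; have [->|/x0//] := eqVneq j i.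
  have := xL0 i; rewrite LE eqxx mxE (bigD1 i)//= big1 ?addr0; last first.
    by move=> k /x0 ->; rewrite mul0r.
  by move/eqP; rewrite mulf_eq0 (negbTE ui0) orbF => /eqP.
pose K j : set RT := if j == i then [set - a] else setT.
have mK j : measurable (K j).
  by rewrite /K; case: ifP => // _; exact: measurable_set1.
have mH : measurable [set t : n.-tuple RT | forall j, K j (tnth t j)].
  rewrite (_ : [set _ | _] = \bigcap_(j in [set: 'I_n]) (fun t => tnth t j) @^-1` K j).
    apply: fin_bigcap_measurable => // j _.
    by apply: measurable_preimT (mK j); exact: measurable_tnth.
  by apply/seteqP; split=> [t h j _|t h j]; exact: h.
have [c c0 cE] := pow_lebesgue_mulmx uL.
have := cE _ mH; rewrite pow_measure_prod// (bigD1 i)//= {2}/K eqxx.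
rewrite lebesgue_measure_set1 mul0e mule0 => <-.
congr (pow_measure _ _ _); apply/seteqP; split => t /=.
  move=> /eqP; rewrite addr_eq0 => /eqP at0 j; rewrite /K.
  case: eqVneq => //= ->; rewrite tnth_mktuple LE eqxx at0 opprK.
  by apply: eq_bigr => k _; rewrite mxE.
move=> /(_ i); rewrite /K eqxx /= tnth_mktuple LE eqxx => h.
rewrite -[a]opprK -h (eq_bigr (fun k => tnth t k * u k)) ?addNr//.
by move=> k _; rewrite mxE.
Qed.

End lebesgue_tuples.

(** * Weights and the cone over a simplex *)

Section simplex.
Context (R : realType) (m : nat) (v : 'I_m.+1 -> 'rV[R]_m).
Local Notation RT := (measurableTypeR R).
Local Notation leb := (@lebesgue_measure R).

(* The matrix with rows (1, v_i): it maps weights w to (sum w_i, sum w_i v_i). *)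
Definition homogeneous_mx : 'M[R]_m.+1 :=
  \matrix_(i, j) oapp (fun j' => v i 0 j') 1 (unlift ord0 j).

Local Notation L := homogeneous_mx.

Lemma homogeneous_mx0 i : L i ord0 = 1.
Proof. by rewrite mxE unlift_none. Qed.

Lemma homogeneous_mxS i j : L i (lift ord0 j) = v i 0 j.
Proof. by rewrite mxE liftK. Qed.

Lemma mulmx_homogeneous0 s :
  tnth (mulmx_tuple L s) ord0 = \sum_i tnth s i.
Proof.
rewrite tnth_mulmx_tuple; apply: eq_bigr => i _.
by rewrite homogeneous_mx0 mulr1.
Qed.

Lemma mulmx_homogeneousS s j :
  tnth (mulmx_tuple L s) (lift ord0 j) = \sum_i tnth s i * v i 0 j.
Proof.
rewrite tnth_mulmx_tuple; apply: eq_bigr => i _.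
by rewrite homogeneous_mxS.
Qed.

Hypothesis uL : L \in unitmx.

Lemma mulmx_homogeneous_inj : injective (mulmx_tuple L).
Proof.
move=> s t st; apply: eq_from_tnth => i.
have : (\row_i tnth s i) *m L = (\row_i tnth t i) *m L.
  by rewrite -!row_mulmx_tuple st.
move/(congr1 (mulmx^~ (invmx L))); rewrite !mulmxK// => /rowP/(_ i).
by rewrite !mxE.
Qed.

(** The barycentric coordinates of y are the entries of (1, y) times the inverse of [L]; the hull is
    where all of them are nonnegative. *)
Lemma measurable_conv_hull :
  measurable [set y : m.-tuple RT | conv_hull v (\row_i tnth y i)].
Proof.
pose g (y : m.-tuple RT) := mulmx_tuple (invmx L) [tuple of 1 :: y].
have mg : measurable_fun setT g.
  have mc := @measurable_cons _ _ (m.-tuple RT) RT (fun=> 1 : R) m id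
    (@measurable_cst _ _ _ _ _ _) (@measurable_id _ _ _).
  exact: (measurableT_comp (measurable_mulmx_tuple _) mc).
have Lg y : mulmx_tuple L (g y) = [tuple of 1 :: y].
  apply: eq_from_tnth => j; rewrite tnth_mktuple row_mulmx_tuple -mulmxA.
  by rewrite mulVmx// mulmx1 mxE.
rewrite (_ : [set _ | _] = [set y | @box _ RT _ `[0%R, +oo[%classic (g y)]).
  apply: (measurable_preimT mg); apply: measurable_box; exact: measurable_itv.
apply/seteqP; split => y /=.
  move=> [w [w0 w1 yw]] i; rewrite (_ : g y = [tuple w i | i < m.+1]).
    by rewrite tnth_mktuple /= in_itv /= w0.
  apply: mulmx_homogeneous_inj; rewrite Lg; apply: eq_from_tnth => j.
  case: (unliftP ord0 j) => [j' ->|->].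
    rewrite tnthS mulmx_homogeneousS; have /rowP/(_ j') := yw.
    rewrite mxE => ->; rewrite summxE; apply: eq_bigr => k _.
    by rewrite mxE tnth_mktuple.
  rewrite tnth0 mulmx_homogeneous0 -w1.
  by apply: eq_bigr => k _; rewrite tnth_mktuple.
move=> gy; exists (fun i => tnth (g y) i); split.
- by move=> i; have := gy i; rewrite /= in_itv /= andbT.
- by rewrite -mulmx_homogeneous0 Lg tnth0.
- apply/rowP => j; rewrite mxE summxE.
  have := mulmx_homogeneousS (g y) j; rewrite Lg tnthS => ->.
  by apply: eq_bigr => k _; rewrite mxE.
Qed.

(** A point of the truncated cone is (r, r y) with 0 < r <= 1: [head_itv] bounds r and
    [dehomogenize] recovers y. *)
Let head_itv (z : m.+1.-tuple RT) := 0 < thead z <= 1.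

Let dehomogenize (z : m.+1.-tuple RT) : m.-tuple RT :=
  map_coord (fun=> *%R (thead z : R)^-1) [tuple of behead z].

Let measurable_hull_cone (F : set (m.-tuple RT)) : measurable F ->
  measurable [set z : m.+1.-tuple RT | head_itv z /\ F (dehomogenize z)].
Proof.
(* [g] is [dehomogenize] with the inverse written as a real power of the absolute value, a
   measurable function; the two agree where the head is positive. *)
move=> mF; pose g (z : m.+1.-tuple RT) : m.-tuple RT :=
  [tuple `|tnth z ord0| `^ (-1) * tnth z (lift ord0 j) | j < m].
have mg : measurable_fun setT g.
  apply/measurable_fun_tnthP => j.
  rewrite (_ : _ \o _ =
      fun z => `|tnth z ord0| `^ (-1) * tnth z (lift ord0 j)); last first.
    by apply/funext => z /=; rewrite tnth_mktuple.
  apply: measurable_funM; last exact: measurable_tnth.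
  have mn : measurable_fun setT (fun z : m.+1.-tuple RT => `|tnth z ord0|).
    apply: measurableT_comp; first exact: normr_measurable.
    exact: measurable_tnth.
  by apply: (@measurableT_comp _ _ _ _ _ _ (fun x : R => x `^ (-1))).
rewrite (_ : [set _ | _] = [set z : m.+1.-tuple RT |
    (`]0%R, 1%R]%classic : set RT) (tnth z ord0)] `&` [set z | F (g z)]).
  apply: measurableI; last exact: (measurable_preimT mg).
  apply: (measurable_preimT (measurable_tnth ord0)); exact: measurable_itv.
have gE z : head_itv z -> g z = dehomogenize z.
  rewrite /head_itv /thead => /andP[z0 _]; apply: eq_from_tnth => j.
  rewrite !tnth_mktuple powR_inv1// gtr0_norm//; congr (_ * _).
  by rewrite {1}(tuple_eta z) tnthS.
apply/seteqP; split => z /=; rewrite in_itv /=.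
  by move=> [hz]; rewrite gE.
by move=> [hz]; rewrite gE.
Qed.

(** Weights s of total r go to (r, r y) with y = r^-1 sum_i s_i v_i, and the s_i / r are barycentric
    coordinates of y. Conversely, barycentric coordinates w of y give s = r w by injectivity. *)
Let hull_cone_preimage (E : set (m.-tuple RT)) :
  [set s | [/\ forall i, 0 <= tnth s i, 0 < \sum_i tnth s i <= 1 &
    E [tuple (\sum_i tnth s i)^-1 * \sum_i (tnth s i * v i 0 j) | j < m]]] =
  mulmx_tuple L @^-1` [set z | head_itv z /\
    (conv_hull v (\row_i tnth (dehomogenize z) i) /\ E (dehomogenize z))].
Proof.
apply/seteqP; split => s /=.
- move=> [s0 s1 Es]; set r := \sum_i tnth s i in s1 Es.
  have hr : thead (mulmx_tuple L s) = r by rewrite /thead mulmx_homogeneous0.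
  have r0 : 0 < r by case/andP: s1.
  have dE : dehomogenize (mulmx_tuple L s) =
      [tuple r^-1 * \sum_i (tnth s i * v i 0 j) | j < m].
    apply: eq_from_tnth => j; rewrite !tnth_mktuple hr; congr (_ * _).
    have := mulmx_homogeneousS s j.
    by rewrite {1}(tuple_eta (mulmx_tuple L s)) tnthS => ->.
  rewrite /head_itv hr; split => //; rewrite dE; split => //.
  exists (fun i => r^-1 * tnth s i); split.
  + by move=> i; rewrite mulr_ge0 ?invr_ge0// ltW.
  + by rewrite -mulr_sumr mulVf ?gt_eqF.
  + apply/rowP => j; rewrite mxE tnth_mktuple summxE mulr_sumr.
    by apply: eq_bigr => i _; rewrite mxE mulrA.
- move=> [hz [[w [w0 w1 yw]] Ey]].
  have hr : thead (mulmx_tuple L s) = \sum_i tnth s i.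
    by rewrite /thead mulmx_homogeneous0.
  move: hz; rewrite /head_itv hr => hz; set r := \sum_i tnth s i in hr hz *.
  have r0 : 0 < r by case/andP: hz.
  have dE : dehomogenize (mulmx_tuple L s) =
      [tuple r^-1 * \sum_i (tnth s i * v i 0 j) | j < m].
    apply: eq_from_tnth => j; rewrite !tnth_mktuple hr; congr (_ * _).
    have := mulmx_homogeneousS s j.
    by rewrite {1}(tuple_eta (mulmx_tuple L s)) tnthS => ->.
  rewrite dE in yw Ey; split => // i.
  rewrite (_ : s = [tuple r * w i | i < m.+1]).
    by rewrite tnth_mktuple mulr_ge0// ltW.
  apply: mulmx_homogeneous_inj; apply: eq_from_tnth => j.
  case: (unliftP ord0 j) => [j' ->|->].
    rewrite !mulmx_homogeneousS; have /rowP/(_ j') := yw.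
    rewrite mxE tnth_mktuple summxE => /(congr1 ( *%R r)).
    rewrite mulrA mulfV ?gt_eqF// mul1r => ->; rewrite mulr_sumr.
    by apply: eq_bigr => k _; rewrite mxE tnth_mktuple mulrA.
  rewrite !mulmx_homogeneous0 -/r.
  rewrite (eq_bigr (fun k => r * w k)) -?mulr_sumr ?w1 ?mulr1// => k _.
  by rewrite tnth_mktuple.
Qed.

Lemma measurable_weights (E : set (m.-tuple RT)) : measurable E ->
  measurable [set s : m.+1.-tuple RT | [/\ forall i, 0 <= tnth s i,
    0 < \sum_i tnth s i <= 1 &
    E [tuple (\sum_i tnth s i)^-1 * \sum_i (tnth s i * v i 0 j) | j < m]]].
Proof.
move=> mE; rewrite hull_cone_preimage.
apply: measurable_preimT; first exact: measurable_mulmx_tuple.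
exact: (measurable_hull_cone (measurableI _ _ measurable_conv_hull mE)).
Qed.

(** The linear bijection contributes the factor [c] and the slicing of the cone the integral of r^m,
    both independent of [E]. *)
Lemma pow_lebesgue_weights : exists2 C : \bar R, (0 <= C)%E &
  forall E : set (m.-tuple RT), measurable E ->
  pow_measure leb m.+1 [set s | [/\ forall i, 0 <= tnth s i,
      0 < \sum_i tnth s i <= 1 &
      E [tuple (\sum_i tnth s i)^-1 * \sum_i (tnth s i * v i 0 j) | j < m]]] =
  (C * pow_measure leb m
     [set y | conv_hull v (\row_i tnth y i) /\ E y])%E.
Proof.
have [c c0 cE] := pow_lebesgue_mulmx uL.
exists (c * \int[leb]_(r in `]0%R, 1%R]) (r ^+ m)%:E)%E.
  apply: mule_ge0 => //; apply: integral_ge0 => r /=.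
  by rewrite in_itv /= => /andP[r0 _]; rewrite lee_fin exprn_ge0// ltW.
move=> E mE; have mF := measurableI _ _ measurable_conv_hull mE.
rewrite -muleA -(pow_lebesgue_cone mF) -(cE _ (measurable_hull_cone mF)).
by rewrite hull_cone_preimage.
Qed.

End simplex.

(** * The numerical measure of a normal matrix *)

Section normal_matrix.
Context (R : realType).
Local Notation RT := (measurableTypeR R).
Local Notation RR := (measurableTypeR R * measurableTypeR R)%type.
Local Notation leb := (@lebesgue_measure R).
Local Notation cplan n := (pow_measure (@planar_lebesgue R) n).
Local Open Scope complex_scope.
Local Open Scope sesquilinear_scope.

Lemma numerical_measureE n (A : 'M[R[i]]_n) (B : set RR) :
  numerical_measure A B = ((fine (surface_measure (@sphere R n)))^-1%:E *
    ((n.*2)%:R%:E * cplan n (@cball R n `&` rayleigh A @^-1` B)))%E.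
Proof.
by rewrite /numerical_measure /surface_measure /cvolume cone_preimageE.
Qed.

Lemma surface_sphereE n :
  surface_measure (@sphere R n) = ((n.*2)%:R%:E * cplan n (@cball R n))%E.
Proof.
rewrite /surface_measure /cvolume; congr (_ * pow_measure _ _ _)%E.
(* The whole sphere is the event [setT] for the zero matrix. *)
have := @cone_preimageE R n 0 setT.
rewrite (_ : [set x : 'cV[R[i]]_n | setT (to_plane (qform 0 x))] = setT).
  by rewrite preimage_setT !setIT.
by apply/seteqP; split.
Qed.

Lemma cball_gt0 n : (0 < cplan n.+1 (@cball R n.+1))%E.
Proof.
(* With 2(n+1) real coordinates in ]0, e], the sum of squares is at most 2(n+1) e^2 = e <= 1, so the
   box lies in the ball. *)
pose e : R := (n.+1.*2)%:R^-1.
have e0 : 0 < e by rewrite invr_gt0 ltr0n.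
have mI : measurable (`]0, e]%classic : set RT) by exact: measurable_itv.
pose K : set RR := `]0, e]%classic `*` `]0, e]%classic.
have mK : measurable K by exact: measurableX.
have muK : planar_lebesgue K = (e * e)%:E.
  have E : leb `]0, e]%classic = e%:E.
    by rewrite lebesgue_measure_itv /= lte_fin e0 -EFinD subr0.
  by rewrite /planar_lebesgue product_measure1E// [X in (X * _)%E]E
    [X in (_ * X)%E]E.
apply: (@lt_le_trans _ _ (cplan n.+1 (@box _ _ n.+1 K))).
  rewrite (@pow_measure_prod _ _ _ (@planar_lebesgue R) n.+1 (fun=> K))//.
  apply: (big_ind (fun x => 0 < x)%E) => //.
    by move=> x y x0 y0; exact: mule_gt0.
  by move=> i _; rewrite [X in (_ < X)%E]muK lte_fin mulr_gt0.
apply: le_measure; rewrite ?inE.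
- exact: measurable_box.
- exact: measurable_cball.
move=> t Kt; rewrite /cball /=; apply/andP; split.
  rewrite /sqnorm big_ord_recl ltr_pwDl//; last first.
    by apply: sumr_ge0 => i _; rewrite addr_ge0 ?sqr_ge0.
  have [/=] := Kt ord0; rewrite !in_itv /= => /andP[t1 _] _.
  by rewrite ltr_pwDl ?sqr_ge0// exprn_gt0.
apply: (@le_trans _ _ (\sum_(i < n.+1) (e + e) * e)).
  apply: ler_sum => i _; have [/=] := Kt i; rewrite !in_itv /=.
  by move=> /andP[t1 t2] /andP[t3 t4]; nra.
rewrite sumr_const card_ord -mulr_natr.
have -> : (e + e) * e * n.+1%:R = e.
  have ne : n.+1%:R * (e + e) = 1.
    rewrite /e -muln2 natrM; by field; rewrite addrC natr1 pnatr_eq0.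
  by rewrite mulrAC [_ * n.+1%:R]mulrC ne mul1r.
by rewrite invf_le1 ?ltr0n// ler1n.
Qed.

(** The dimension is a successor because the sphere of C^0 is empty. *)
Lemma numerical_measure_setT n (A : 'M[R[i]]_n.+1) :
  numerical_measure A setT = 1%E.
Proof.
rewrite numerical_measureE preimage_setT setIT -surface_sphereE.
(* Positivity and finiteness both matter: [fine] sends +oo to 0 and the inverse of 0 is 0, so the
   total mass would otherwise be 0. *)
have S0 : (0 < surface_measure (@sphere R n.+1))%E.
  by rewrite surface_sphereE; apply: mule_gt0; [rewrite lte_fin ltr0n|exact: cball_gt0].
have Soo : surface_measure (@sphere R n.+1) \is a fin_num.
  rewrite surface_sphereE fin_numM//.
  by rewrite ge0_fin_numE ?cball_finite.
rewrite -{2}(fineK Soo) -EFinM mulVf//.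
by rewrite gt_eqF// fine_gt0// S0 ltey_eq Soo.
Qed.

Lemma inner_mulmx n (P B : 'M[R[i]]_n) (x : 'cV[R[i]]_n) :
  inner (B *m (P *m x)) (P *m x) = inner (P ^t* *m B *m P *m x) x.
Proof. by rewrite /inner trmx_mul map_mxM /= !mulmxA. Qed.

Lemma inner_diag n (d : 'rV[R[i]]_n) (t : n.-tuple (R * R)) :
  inner (diag_mx d *m of_planes t) (of_planes t) =
  \sum_i (plane_normsq (tnth t i))%:C * d 0 i.
Proof.
rewrite /inner mxE; apply: eq_bigr => i _.
rewrite mul_diag_mx !mxE mulrCA mulrC; congr (_ * _).
rewrite /of_plane /plane_normsq; case: (tnth t i) => a b /=.
apply/eqP; rewrite eq_complex /=; apply/andP; split; apply/eqP; ring.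
Qed.

Section spectral.
Variables (n : nat) (A : 'M[R[i]]_n).
Hypothesis normalA : A \is normalmx.
Local Notation P := (spectralmx A).
Local Notation d := (spectral_diag A).

(** Squared moduli of the coordinates in the orthonormal eigenbasis given by the unitary matrix
    [P]. *)
Let s_ (t : n.-tuple RR) : n.-tuple RT :=
  map_coord (fun=> (@plane_normsq R : RR -> RT)) (mulmx_planes P t).

Let sqnormE t : sqnorm t = \sum_i tnth (s_ t) i.
Proof.
have : (sqnorm t)%:C = (sqnorm (mulmx_planes P t))%:C.
  rewrite -!inner_of_planes of_planes_mulmx.
  have := inner_mulmx P 1%:M (of_planes t); rewrite mul1mx => ->.
  rewrite mulmx1 -invmx_unitary ?spectral_unitarymx// mulVmx ?spectral_unit//.
  by rewrite mul1mx.
move=> [->]; apply: eq_bigr => i _.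
by rewrite [RHS]tnth_mktuple.
Qed.

Let qformE t : qform A (of_planes t) = \sum_i (tnth (s_ t) i)%:C * d 0 i.
Proof.
rewrite /qform {1}(orthomx_spectralP normalA) invmx_unitary ?spectral_unitarymx//.
rewrite -inner_mulmx -of_planes_mulmx inner_diag.
by apply: eq_bigr => i _; rewrite [in RHS]tnth_mktuple.
Qed.

(** Serves to carry affine relations between the eigenvalues over to the whole numerical range. *)
Lemma numerical_range_weights w : numerical_range A w ->
  exists s : 'I_n -> R, \sum_i s i = 1 /\ w = \sum_i (s i)%:C * d 0 i.
Proof.
move=> [x Sx <-]; have [t tx] := of_planes_surj x.
exists (fun i => tnth (s_ t) i); rewrite -sqnormE -qformE tx; split => //.
by move/sphereE : Sx; rewrite -tx inner_of_planes => -[].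
Qed.

(** In the eigenbasis the ball condition bounds the total weight and the Rayleigh quotient is the
    weighted mean of the eigenvalues. *)
Lemma numerical_measure_weights : exists2 C : \bar R, (0 <= C)%E &
  forall B : set RR, measurable B ->
  let W := [set s : n.-tuple RT | [/\ forall i, 0 <= tnth s i,
    0 < \sum_i tnth s i <= 1 &
    B ((\sum_i tnth s i)^-1 * \sum_i (tnth s i * complex.Re (d 0 i)),
       (\sum_i tnth s i)^-1 * \sum_i (tnth s i * complex.Im (d 0 i)))]] in
  measurable W -> numerical_measure A B = (C * pow_measure leb n W)%E.
Proof.
have [c c0 cE] := pow_planar_mulmx (spectral_unit A).
have [e eE] := @planar_normsq R.
have N0 : (0 <= (fine (surface_measure (@sphere R n)))^-1%:E)%E.
  by rewrite lee_fin invr_ge0 fine_ge0// surface_sphereE mule_ge0.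
exists ((fine (surface_measure (@sphere R n)))^-1%:E *
    ((n.*2)%:R%:E * (c * (\prod_(i < n) e%:num)%:E)))%E.
  by rewrite !mule_ge0// lee_fin ?prodr_ge0.
move=> B mB W mW; rewrite numerical_measureE -!muleA; congr (_ * (_ * _))%E.
have mI : measurable (`[0%R, +oo[%classic : set RT) by exact: measurable_itv.
(* [W] is pulled back first by the squared moduli, with a factor [e] for each coordinate, then by
   the unitary matrix, with the factor [c]. *)
rewrite -(@pow_measure_map _ _ _ _ _ (@planar_lebesgue R) leb _ n
  (fun=> (@plane_normsq R : RR -> RT)) (fun=> e) mI)//; last 2 first.
- by move=> _; exact: measurable_plane_normsq.
- by move=> s [s0 _ _] i; rewrite /= in_itv /= s0.
rewrite -cE; last first.
  apply: measurable_preimT mW; apply: measurable_map_coord => i.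
  exact: measurable_plane_normsq.
have rE t : rayleigh A t = (
    (\sum_i tnth (s_ t) i)^-1 * \sum_i (tnth (s_ t) i * complex.Re (d 0 i)),
    (\sum_i tnth (s_ t) i)^-1 * \sum_i (tnth (s_ t) i * complex.Im (d 0 i))).
  rewrite /rayleigh qformE sqnormE !raddf_sum; congr (_ * _, _ * _);
  by apply: eq_bigr => i _; case: (d 0 i) => x y /=; rewrite mul0r ?subr0 ?addr0.
have s0 t i : 0 <= tnth (s_ t) i.
  by rewrite tnth_mktuple addr_ge0 ?sqr_ge0.
congr (pow_measure _ _ _); apply/seteqP.
split => t; rewrite /cball /= sqnormE rE.
  by move=> [? ?]; split => // i; exact: s0.
by case.
Qed.

End spectral.

End normal_matrix.

(** * The density *)

Section density.
Context (R : realType).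
Local Notation RT := (measurableTypeR R).
Local Notation RR := (measurableTypeR R * measurableTypeR R)%type.
Local Notation leb := (@lebesgue_measure R).

(** Columns [ja] and [jb] of the vertices carry the knots, so the event B becomes a condition [E] on
    two coordinates of a point of R^m, and the two weight formulas combine. *)
Lemma numerical_measure_hull m (A : 'M[R[i]]_m.+1) (v : 'I_m.+1 -> 'rV[R]_m)
    (ja jb : 'I_m) :
  A \is normalmx -> homogeneous_mx v \in unitmx ->
  (forall i, v i 0 ja = complex.Re (spectral_diag A 0 i)) ->
  (forall i, v i 0 jb = complex.Im (spectral_diag A 0 i)) ->
  exists2 C : \bar R, (0 <= C)%E & forall B : set RR, measurable B ->
  numerical_measure A B = (C * pow_measure leb m
    [set y | conv_hull v (\row_i tnth y i) /\ B (tnth y ja, tnth y jb)])%E.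
Proof.
move=> normalA uL va vb.
have [C1 C10 C1E] := numerical_measure_weights normalA.
have [C2 C20 C2E] := pow_lebesgue_weights uL.
exists (C1 * C2)%E; first exact: mule_ge0.
move=> B mB; pose E : set (m.-tuple RT) := [set y | B (tnth y ja, tnth y jb)].
have mE : measurable E.
  apply: measurable_preimT mB; apply: measurable_fun_pair; exact: measurable_tnth.
rewrite -muleA -(C2E _ mE).
have mW := measurable_weights uL mE.
have WE : [set s : m.+1.-tuple RT | [/\ forall i, 0 <= tnth s i,
    0 < \sum_i tnth s i <= 1 &
    E [tuple (\sum_i tnth s i)^-1 * \sum_i (tnth s i * v i 0 j) | j < m]]] =
  [set s : m.+1.-tuple RT | [/\ forall i, 0 <= tnth s i,
    0 < \sum_i tnth s i <= 1 &
    B ((\sum_i tnth s i)^-1 *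
         \sum_i (tnth s i * complex.Re (spectral_diag A 0 i)),
       (\sum_i tnth s i)^-1 *
         \sum_i (tnth s i * complex.Im (spectral_diag A 0 i)))]].
  apply/seteqP; split => s /= [s0 s1 sE]; split => //; move: sE;
  rewrite /E /= !tnth_mktuple; congr (B (_ * _, _ * _));
  by apply: eq_bigr => i _; rewrite ?va ?vb.
by rewrite WE in mW *; exact: C1E.
Qed.

(** Tonelli's theorem turns the planar integral into the first two slicings that build the power
    measure. *)
Lemma pow_lebesgue_sections k (S : set (k.+2.-tuple RT)) : measurable S ->
  let f (z : RR) :=
    pow_measure leb k [set t | S (cons_pair (z.1, cons_pair (z.2, t)))] in
  measurable_fun setT f /\
  (\int[@planar_lebesgue R]_z f z = pow_measure leb k.+2 S)%E.
Proof.
move=> mS f.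
have mf : measurable_fun setT f.
  have mg : measurable_fun setT (fun p : RR * k.-tuple RT =>
      cons_pair (p.1.1, cons_pair (p.1.2, p.2))).
    apply: measurable_cons.
      exact: (measurableT_comp measurable_fst measurable_fst).
    apply: measurable_cons; last exact: measurable_snd.
    exact: (measurableT_comp measurable_snd measurable_fst).
  have := measurable_fun_xsection (pow_measure leb k) (measurable_preimT mg mS).
  congr (measurable_fun _ _); apply/funext => x /=; congr (pow_measure _ _ _).
  by apply/seteqP; split => t; rewrite /xsection /= inE.
split => //; rewrite /planar_lebesgue fubini_tonelli1//.
rewrite pow_measureS; apply: eq_integral => x _.
by rewrite pow_measureS.
Qed.

(** The B-spline of a simplex of arbitrary volume, before normalisation. *)
Definition hull_section k (v : 'I_k.+3 -> 'rV[R]_(2 + k)) (z : RR) : \bar R :=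
  volume [set t : 'rV[R]_k | conv_hull v (row_mx (row2 z) t)].

Lemma row_cons2 k (z : RR) (t : k.-tuple RT) :
  \row_i tnth (cons_pair (z.1, cons_pair (z.2, t)) : (2 + k).-tuple RT) i =
  row_mx (row2 z) (\row_i tnth t i) :> 'rV[R]_(2 + k).
Proof.
apply/rowP => i; rewrite mxE; case: (split_ordP i) => j ->.
  rewrite row_mxEl mxE (tnth_nth z.1) /=.
  by case: j => [[|[|//]] ?].
by rewrite row_mxEr mxE !(tnth_nth z.1).
Qed.

Lemma hull_section_ge0 k (v : 'I_k.+3 -> 'rV[R]_(2 + k)) z :
  (0 <= hull_section v z)%E.
Proof. exact: measure_ge0. Qed.

Section hull.
Variables (k : nat) (v : 'I_k.+3 -> 'rV[R]_(2 + k)).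
Hypothesis uL : homogeneous_mx v \in unitmx.

(** The casts read length k.+2 as 2 + k, so that the planar coordinates form the left block. *)
Let H (B : set RR) : set (k.+2.-tuple RT) :=
  [set y | conv_hull v (\row_i tnth (y : (2 + k).-tuple RT) i) /\
    B (tnth (y : (2 + k).-tuple RT) (lshift k ord0),
       tnth (y : (2 + k).-tuple RT) (lshift k ord_max))].

Let mH B : measurable B -> measurable (H B).
Proof.
move=> mB; apply: measurableI; first exact: measurable_conv_hull.
apply: measurable_preimT mB; apply: measurable_fun_pair; exact: measurable_tnth.
Qed.

Let HE B z t : H B (cons_pair (z.1, cons_pair (z.2, t))) <->
  conv_hull v (row_mx (row2 z) (\row_i tnth t i)) /\ B z.
Proof.
rewrite /H /= row_cons2 (_ : (_, _) = z)//.
by rewrite [RHS]surjective_pairing; congr pair; rewrite (tnth_nth z.1).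
Qed.

Lemma measurable_hull_section : measurable_fun setT (hull_section v).
Proof.
have [mf _] := pow_lebesgue_sections (mH measurableT).
apply: eq_measurable_fun mf => z _; congr (pow_measure _ _ _).
apply/seteqP; split => t /=; first by move=> /HE[].
by move=> h; apply/HE.
Qed.

Lemma integral_hull_section (B : set RR) : measurable B ->
  (\int[@planar_lebesgue R]_(z in B) hull_section v z = pow_measure leb k.+2 (H B))%E.
Proof.
move=> mB; have [_ <-] := pow_lebesgue_sections (mH mB).
rewrite integral_mkcond; apply: eq_integral => z _; rewrite patchE.
case: ifPn; rewrite ?inE ?notin_setE => Bz.
  congr (pow_measure _ _ _).
  by apply/seteqP; split => t /=; [move=> h; apply/HE|move=> /HE[]].
rewrite (_ : [set _ | _] = set0) ?measure0//.
by apply/seteqP; split => // t /= /HE[].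
Qed.

End hull.

End density.

Section density_hull.
Context (R : realType) (k : nat) (A : 'M[R[i]]_k.+3).
Variable v : 'I_k.+3 -> 'rV[R]_(2 + k).
Local Notation RT := (measurableTypeR R).
Local Notation RR := (measurableTypeR R * measurableTypeR R)%type.
Hypothesis normalA : A \is normalmx.
Hypothesis uL : homogeneous_mx v \in unitmx.
Hypothesis v_knots :
  forall i, lsubmx (v i) = row2 (to_plane (spectral_diag A 0 i)).

Let vol := volume (conv_hull v).

Let numerical_measure_section : exists2 C : \bar R, (0 <= C)%E &
  forall B : set RR, measurable B -> numerical_measure A B =
    (C * \int[@planar_lebesgue R]_(z in B) hull_section v z)%E.
Proof.
have va i : v i 0 (lshift k ord0) = complex.Re (spectral_diag A 0 i).
  by have /rowP/(_ ord0) := v_knots i; rewrite !mxE.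
have vb i : v i 0 (lshift k ord_max) = complex.Im (spectral_diag A 0 i).
  by have /rowP/(_ ord_max) := v_knots i; rewrite !mxE.
have [C C0 CE] := @numerical_measure_hull R (2 + k) A v _ _ normalA uL va vb.
by exists C => // B mB; rewrite CE// integral_hull_section.
Qed.

Let integral_section_setT :
  (\int[@planar_lebesgue R]_z hull_section v z = vol)%E.
Proof.
rewrite (integral_hull_section uL measurableT).
apply: (congr1 (pow_measure (@lebesgue_measure R) k.+2)).
by apply/seteqP; split => [y []|y vy].
Qed.

(** For B the whole plane the formula reads 1 = C vol, which forces vol to be positive and finite
    and C to be its inverse. *)
Let numerical_measureE : [/\ (0 < vol)%E, vol \is a fin_num &
  forall B : set RR, measurable B -> numerical_measure A B =
    ((fine vol)^-1%:E * \int[@planar_lebesgue R]_(z in B) hull_section v z)%E].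
Proof.
have [C C0 CE] := numerical_measure_section.
have := CE _ measurableT.
rewrite (@numerical_measure_setT R k.+2 A) integral_section_setT => Cvol.
have vol0 : (0 <= vol)%E by exact: measure_ge0.
have volp : (0 < vol)%E.
  rewrite lt0e vol0 andbT; apply/eqP => v0; move: Cvol.
  by rewrite v0 mule0 => /eqP; rewrite onee_eq0.
have Cp : (0 < C)%E.
  rewrite lt0e C0 andbT; apply/eqP => c0; move: Cvol.
  by rewrite c0 mul0e => /eqP; rewrite onee_eq0.
have volf : vol \is a fin_num.
  rewrite ge0_fin_numE// ltey; apply/eqP => vy; move: Cvol.
  by rewrite vy gt0_muley.
split => // B mB; rewrite CE//; congr (_ * _)%E.
have volnz : fine vol != 0 by rewrite gt_eqF// fine_gt0// volp ltey_eq volf.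
rewrite -[LHS]mule1 -[1%E]/((1%R)%:E) -(mulfV volnz) EFinM fineK// muleA -Cvol.
by rewrite mul1e.
Qed.

Lemma volume_conv_hull_gt0 : (0 < vol)%E.
Proof. by case: numerical_measureE. Qed.

Lemma volume_conv_hull_fin_num : vol \is a fin_num.
Proof. by case: numerical_measureE. Qed.

(** Both functions have the same integral over every measurable set, hence agree almost
    everywhere. *)
Lemma numerical_density_section :
  ae_eq (@planar_lebesgue R) setT (numerical_density A)
    (fun z => (fine vol)^-1%:E * hull_section v z)%E.
Proof.
have [volp volf nE] := numerical_measureE.
have ms := measurable_hull_section uL.
have s0 z : (0 <= hull_section v z)%E by exact: hull_section_ge0.
have i0 : (0 <= (fine vol)^-1%:E)%E by rewrite lee_fin invr_ge0 fine_ge0// ltW.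
(* Absolute continuity comes first; without it the Radon-Nikodym derivative would only be a default
   value. *)
have dom : charge_of_finite_measure (numerical_measure A) `<< @planar_lebesgue R.
  apply/null_content_dominatesP => B mB B0.
  rewrite /charge_of_finite_measure/=.
  have -> : numerical_measure A B = 0%E.
    rewrite nE// (_ : integral _ _ _ = 0)%E ?mule0//.
    by apply: null_set_integral => //; exact: measurable_funTS.
  by [].
apply: integral_ae_eq => //.
- exact: Radon_Nikodym_integrable.
- exact: measurable_funeM.
move=> B _ mB; rewrite -Radon_Nikodym_integral//.
rewrite [LHS]nE// ge0_integralZl//; exact: measurable_funTS.
Qed.

End density_hull.

(** * Simplices over noncollinear knots *)

Section knots.
Context (R : realType).
Local Notation RT := (measurableTypeR R).
Local Notation leb := (@lebesgue_measure R).

(** In this form it is the linear independence of the rows of [knots_mx], and it excludes fewer than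
    three points. *)
Definition noncollinear n (p : 'I_n -> R * R) : Prop :=
  forall c a b, (forall i, c + a * (p i).1 + b * (p i).2 = 0) ->
    [/\ c = 0, a = 0 & b = 0].

(** An affine function that vanishes at the eigenvalues vanishes on the numerical range, hence on a
    square around an interior point, and is therefore zero. *)
Lemma interior_noncollinear n (A : 'M[R[i]]_n) : A \is normalmx ->
  [set p : R * R | numerical_range A (of_plane p)]° !=set0 ->
  noncollinear (fun i => to_plane (spectral_diag A 0 i)).
Proof.
move=> normalA [p pA] c a b line.
have inline (x y : R) : numerical_range A (of_plane (x, y)) ->
    c + a * x + b * y = 0.
  move=> /(numerical_range_weights normalA)[s [s1 sE]].
  have xE : x = \sum_i s i * complex.Re (spectral_diag A 0 i).
    have := congr1 (@complex.Re R) sE; rewrite /= raddf_sum => ->.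
    by apply: eq_bigr => i _; case: (spectral_diag A 0 i) => u w /=; ring.
  have yE : y = \sum_i s i * complex.Im (spectral_diag A 0 i).
    have := congr1 (@complex.Im R) sE; rewrite /= raddf_sum => ->.
    by apply: eq_bigr => i _; case: (spectral_diag A 0 i) => u w /=; ring.
  rewrite xE yE -[c]mulr1 -s1 !mulr_sumr -!big_split big1// => i _ /=.
  by have := congr1 ( *%R (s i)) (line i); rewrite mulr0 /= => <-; ring.
have [e /= e0 eA] : exists2 e : R, 0 < e & forall x y, `|p.1 - x| < e ->
    `|p.2 - y| < e -> numerical_range A (of_plane (x, y)).
  have /nbhs_ballP[e /= e0 eA] := pA; exists e => // x y xe ye.
  by apply: (eA (x, y)); split.
have h (x y : R) : `|x| < e -> `|y| < e ->
    c + a * (p.1 + x) + b * (p.2 + y) = 0.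
  move=> xe ye; apply/inline/eA.
    by rewrite opprD addNKr normrN.
  by rewrite opprD addNKr normrN.
have z0 : `|0 : R| < e by rewrite normr0.
have z1 : `|e / 2| < e by rewrite gtr0_norm; lra.
(* Three noncollinear points of the square: p and its shifts by e / 2 along either axis. *)
have h0 := h _ _ z0 z0; have h1 := h _ _ z1 z0; have h2 := h _ _ z0 z1.
have a0 : a = 0.
  have /eqP : a * (e / 2) = 0 by lra.
  by rewrite mulf_eq0 => /orP[/eqP//|]; lra.
have b0 : b = 0.
  have /eqP : b * (e / 2) = 0 by lra.
  by rewrite mulf_eq0 => /orP[/eqP//|]; lra.
by split => //; move: h0; rewrite a0 b0 !mul0r !addr0.
Qed.

Definition knots_mx n (p : 'I_n -> R * R) : 'M[R]_(3, n) :=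
  \matrix_(i < 3, j < n) [:: 1; (p j).1; (p j).2]`_i.

Lemma noncollinear_row_free n (p : 'I_n -> R * R) :
  noncollinear p -> row_free (knots_mx p).
Proof.
move=> np; apply: inj_row_free => x /rowP x0.
have [|c0 a0 b0] := np (x 0 0) (x 0 1) (x 0 2).
  move=> i; have := x0 i; rewrite !mxE !big_ord_recl big_ord0 !mxE /= mulr1 addr0.
  rewrite addrA (mulrC (x 0 _)) (mulrC (x 0 (lift _ (lift _ _)))).
  by rewrite (mulrC (p i).1) (mulrC (p i).2); congr (_ + _ * _ + _ * _ = _);
    congr (x 0 _); apply/val_inj.
apply/rowP => i; rewrite mxE; case: i => [[|[|[|//]]] hi].
- by rewrite -c0; congr (x 0 _); apply/val_inj.
- by rewrite -a0; congr (x 0 _); apply/val_inj.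
- by rewrite -b0; congr (x 0 _); apply/val_inj.
Qed.

Lemma noncollinear_geq3 n (p : 'I_n -> R * R) : noncollinear p -> (3 <= n)%N.
Proof. by move/noncollinear_row_free/eqP <-; exact: rank_leq_col. Qed.

(** The three independent rows of [knots_mx] are completed to an invertible matrix, whose transpose
    is the homogeneous matrix of the lifted vertices. *)
Lemma exists_lift k (p : 'I_k.+3 -> R * R) : noncollinear p ->
  exists2 v : 'I_k.+3 -> 'rV[R]_(2 + k), homogeneous_mx v \in unitmx &
    forall i, lsubmx (v i) = row2 (p i).
Proof.
move=> /noncollinear_row_free; set Q := (knots_mx p : 'M[R]_(3, 3 + k)) => rQ.
pose U : 'M[R]_(3 + k) := row_ebase Q; pose C := col_ebase Q.
(* By full row rank, [Q] spans the same rows as the top three rows of the invertible [U]; the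
   remaining rows of [U] complete it. *)
pose M : 'M[R]_(3 + k) := col_mx Q (dsubmx U).
have QE : Q = C *m usubmx U.
  have := mulmx_ebase Q; rewrite (eqP rQ) pid_mx_row -/C -/U => {1}<-.
  rewrite -mulmxA; congr (_ *m _).
  by rewrite -{1}[U]vsubmxK mul_row_col mul1mx mul0mx addr0.
have uM : M \in unitmx.
  have -> : M = block_mx C 0 0 1%:M *m U.
    rewrite /M QE -{3}[U]vsubmxK mul_block_col !mul0mx mul1mx addr0 add0r.
    by [].
  rewrite unitmx_mul row_ebase_unit andbT.
  by rewrite unitmxE det_ublock det1 mulr1 -unitmxE col_ebase_unit.
(* The first column of the transpose consists of ones and is dropped. *)
pose v (i : 'I_k.+3) : 'rV[R]_(2 + k) :=
  \row_j M^T (i : 'I_(3 + k)) (lift ord0 (j : 'I_k.+2) : 'I_(3 + k)).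
exists v.
  have -> : homogeneous_mx v = M^T.
    apply/matrixP => i j; case: (unliftP ord0 j) => [j' ->|->].
      by rewrite homogeneous_mxS mxE.
    rewrite homogeneous_mx0 mxE.
    rewrite (_ : ord0 = lshift k (ord0 : 'I_3) :> 'I_(3 + k)); last first.
      exact/val_inj.
    by rewrite /M col_mxEu mxE.
  by rewrite unitmx_tr.
move=> i; apply/rowP => j; rewrite [LHS]mxE [LHS]mxE [LHS]mxE [RHS]mxE.
rewrite (_ : lift ord0 _ = lshift k (lift ord0 j : 'I_3) :> 'I_(3 + k)); last first.
  exact/val_inj.
by rewrite /M col_mxEu mxE.
Qed.

(** A kernel vector of a singular homogeneous matrix is an affine equation satisfied by all the
    vertices, so the hull lies in a null hyperplane. *)
Lemma conv_hull_unit m (v : 'I_m.+1 -> 'rV[R]_m) :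
  (0 < volume (conv_hull v))%E -> homogeneous_mx v \in unitmx.
Proof.
apply: contraPT; rewrite -unitmx_tr -row_free_unit -kermx_eq0.
move=> /rowV0Pn[x /sub_kermxP xL xn0]; apply/negP.
have xv i : x 0 ord0 + \sum_j v i 0 j * x 0 (lift ord0 j) = 0.
  have /rowP/(_ i) := xL; rewrite !mxE big_ord_recl mxE homogeneous_mx0 mulr1.
  move=> h; rewrite -[RHS]h; congr (_ + _); apply: eq_bigr => j _.
  by rewrite [RHS]mulrC mxE homogeneous_mxS.
(* If all the linear coefficients vanished, the equation at one vertex would also kill the constant
   term. *)
have [j xj] : exists j, x 0 (lift ord0 j) != 0.
  apply/existsP; rewrite -negb_forall; apply: contraNN xn0 => /forallP x0.
  have x0' j : x 0 (lift ord0 j) = 0 by exact/eqP/x0.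
  apply/eqP/rowP => j; rewrite mxE; case: (unliftP ord0 j) => [j' ->//|->].
  by rewrite -(xv ord0) big1 ?addr0// => j' _; rewrite x0' mulr0.
rewrite -leNgt /volume -[leRHS](@pow_lebesgue_hyperplane _ _ (x 0 ord0)
  (fun j => x 0 (lift ord0 j)) _ xj).
apply: le_pow_lebesgue => t [w [w0 w1 /rowP tE]] /=.
rewrite -[x 0 ord0]mul1r -w1 mulr_suml.
transitivity (\sum_i w i * (x 0 ord0 + \sum_j v i 0 j * x 0 (lift ord0 j))).
  under [RHS]eq_bigr do rewrite mulrDr mulr_sumr.
  rewrite big_split /= exchange_big /=; congr (_ + _); apply: eq_bigr => l _.
  have := tE l; rewrite mxE => ->; rewrite summxE mulr_suml.
  by apply: eq_bigr => i _; rewrite mxE mulrA.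
by rewrite big1// => i _; rewrite xv mulr0.
Qed.

(** Used to pass from the order of the spectral decomposition to that of the given knots. *)
Lemma conv_hull_perm m k (v : 'I_m -> 'rV[R]_k) (s : {perm 'I_m}) :
  conv_hull (v \o s) = conv_hull v.
Proof.
apply/seteqP; split => x [w [w0 w1 ->]].
  exists (w \o (s^-1)%g); split => //=.
    by rewrite -w1 [LHS](reindex_inj (@perm_inj _ s)); apply: eq_bigr => i _ /=;
      rewrite permK.
  by rewrite [RHS](reindex_inj (@perm_inj _ s)); apply: eq_bigr => i _ /=;
    rewrite permK.
exists (w \o s); split => //=.
  by rewrite -w1 [RHS](reindex_inj (@perm_inj _ s)).
by rewrite [LHS](reindex_inj (@perm_inj _ s)).
Qed.

Lemma volume_conv_hull_scale m (v : 'I_m.+1 -> 'rV[R]_m) (c : 'I_m -> R) :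
  (forall j, 0 < c j) -> homogeneous_mx v \in unitmx ->
  volume (conv_hull (fun i => \row_j ((c j)^-1 * v i 0 j))) =
  ((\prod_j (c j)^-1)%:E * volume (conv_hull v))%E.
Proof.
move=> c0 uL; have ci0 j : 0 <= (c j)^-1 by rewrite invr_ge0 ltW.
rewrite /volume -(@pow_measure_map _ _ _ _ _ leb leb setT _ (fun j => *%R (c j))
  (fun j => NngNum (ci0 j)) measurableT _ _ _ (measurable_conv_hull uL))//;
  last first.
  by move=> j E mE _; exact: lebesgue_scale.
congr (pow_measure _ _ _); apply/seteqP.
split => t [w [w0 w1 /rowP tE]]; exists w; split => //; apply/rowP => j.
  rewrite mxE tnth_mktuple; have := tE j; rewrite mxE => ->.
  rewrite !summxE mulr_sumr; apply: eq_bigr => i _.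
  by rewrite !mxE mulrCA mulVKf// gt_eqF.
have := tE j; rewrite mxE tnth_mktuple => /(congr1 ( *%R (c j)^-1)).
rewrite mulKf ?gt_eqF// mxE => ->.
rewrite !summxE mulr_sumr; apply: eq_bigr => i _.
by rewrite !mxE mulrCA.
Qed.

(** Dividing the third coordinate by the volume leaves the projection to the plane unchanged; such a
    coordinate exists only in positive degree, whence [k.+1]. *)
Lemma exists_unit_lift k (v : 'I_k.+4 -> 'rV[R]_(2 + k.+1)) :
  (0 < volume (conv_hull v))%E -> volume (conv_hull v) \is a fin_num ->
  exists2 v' : 'I_k.+4 -> 'rV[R]_(2 + k.+1),
    forall i, lsubmx (v' i) = lsubmx (v i) & volume (conv_hull v') = 1%E.
Proof.
move=> V0 Vf; pose V := fine (volume (conv_hull v)).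
have Vp : 0 < V by rewrite fine_gt0// V0 ltey_eq Vf.
pose j0 : 'I_(2 + k.+1) := rshift 2 ord0.
pose c (j : 'I_(2 + k.+1)) := if j == j0 then V else 1.
have c0 j : 0 < c j by rewrite /c; case: ifP.
exists (fun i => \row_j ((c j)^-1 * v i 0 j)).
  move=> i; apply/rowP => j; rewrite !mxE /c /j0.
  by rewrite eq_lrshift invr1 mul1r.
rewrite (volume_conv_hull_scale c0 (conv_hull_unit V0)).
rewrite (bigD1 j0)//= big1 ?mulr1; last first.
  by move=> j jj0; rewrite /c (negbTE jj0) invr1.
by rewrite /c eqxx -[X in (_ * X)%E](fineK Vf) -EFinM mulVf ?gt_eqF.
Qed.

End knots.

(** * Eigenvalues and the characteristic polynomial *)

(** Unique factorisation: the head of [s] is a root of the other product, and its factor is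
    cancelled on both sides. *)
Lemma prod_XsubC_perm_eq (F : idomainType) (s t : seq F) :
  \prod_(x <- s) ('X - x%:P) = \prod_(x <- t) ('X - x%:P) -> perm_eq s t.
Proof.
elim: s t => [|a s IH] t st.
  have := congr1 (fun p : {poly F} => size p) st.
  by rewrite !size_prod_XsubC => -[/esym/size0nil ->].
have ta : a \in t.
  by rewrite -root_prod_XsubC -st big_cons rootM root_XsubC eqxx.
rewrite perm_sym (perm_trans (perm_to_rem ta))// perm_cons perm_sym.
apply: IH; apply: (@mulfI _ ('X - a%:P)); first by rewrite polyXsubC_eq0.
by move: st; rewrite big_cons => ->; rewrite (perm_big _ (perm_to_rem ta)) big_cons.
Qed.

Lemma char_poly_spectral (C : numClosedFieldType) n (A : 'M[C]_n) :
  A \is normalmx ->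
  char_poly A = \prod_(i < n) ('X - (spectral_diag A 0 i)%:P).
Proof.
move=> /orthomx_spectralP; set P := spectralmx A; set d := spectral_diag A => AE.
have uP : P \in unitmx by exact: spectral_unit.
have PE : map_mx polyC (invmx P) *m map_mx polyC P = 1%:M.
  by rewrite -map_mxM mulVmx// map_mx1.
have -> : char_poly A = char_poly (diag_mx d).
  rewrite /char_poly.
  have -> : char_poly_mx A =
      map_mx polyC (invmx P) *m char_poly_mx (diag_mx d) *m map_mx polyC P.
    rewrite /char_poly_mx mulmxBr mulmxBl -scalemx1 -scalemxAr mulmx1 -scalemxAl.
    by rewrite PE -!map_mxM -AE.
  by rewrite !det_mulmx mulrAC -det_mulmx PE det1 mul1r.
rewrite char_poly_trig ?diag_mx_is_trig//.
by apply: eq_bigr => i _; rewrite mxE eqxx mulr1n.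
Qed.

Lemma spectral_perm (C : numClosedFieldType) n (A : 'M[C]_n) (s : seq C) :
  A \is normalmx -> char_poly A = \prod_(l <- s) ('X - l%:P) ->
  size s = n /\ exists p : {perm 'I_n}, forall i, spectral_diag A 0 i = s`_(p i).
Proof.
move=> nA; rewrite char_poly_spectral// => sE.
have : perm_eq [tuple spectral_diag A 0 i | i < n] s.
  apply: prod_XsubC_perm_eq; rewrite -sE big_tuple.
  by apply: eq_bigr => i _; rewrite tnth_mktuple.
move=> ps; have := perm_size ps; rewrite size_tuple => /esym ss; split => //.
have /tuple_permP[p pE] : perm_eq [tuple spectral_diag A 0 i | i < n]
    (Tuple (introT eqP ss)) by [].
exists p => i; have := congr1 (fun u => u`_i) pE.
rewrite -!tnth_nth !tnth_mktuple.
by rewrite (tnth_nth 0).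
Qed.

(** * Degree zero and the final statement *)

Lemma lift0E (R : realType) (v : 'I_3 -> 'rV[R]_(2 + 0)) (p : 'I_3 -> R * R) :
  (forall i, lsubmx (v i) = row2 (p i)) -> v = @row2 R \o p.
Proof.
move=> vp; apply/funext => i; apply/rowP => j; have /rowP/(_ j) := vp i.
by rewrite mxE /= => <-; congr (v i 0 _); exact/val_inj.
Qed.

(** Volume in dimension zero is a Dirac mass at the empty tuple, so the section is an indicator. *)
Lemma hull_section0 (R : realType) (v : 'I_3 -> 'rV[R]_(2 + 0)) z :
  hull_section v z = (\1_(conv_hull v) (row2 z : 'rV[R]_(2 + 0)))%:E.
Proof.
rewrite /hull_section /volume /= diracE indicE.
have rE t : row_mx (row2 z) t = row2 z :> 'rV[R]_(2 + 0).
  apply/rowP => j; rewrite (_ : j = lshift 0 (j : 'I_2)); last exact/val_inj.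
  by rewrite row_mxEl; congr (row2 z 0 _); exact/val_inj.
by congr (nat_of_bool _)%:R%:E; apply/idP/idP; rewrite !inE /= rE.
Qed.

(** Since [is_bspline] is a relation, existence is stated too; otherwise the second claim could hold
    vacuously. *)
Theorem proposition3p2 (R : realType) (n : nat) (A : 'M[R[i]]_n)
    (lambda : seq R[i])
    (normalA : A \is normalmx)
    (interiorA : ([set p : R * R | numerical_range A (of_plane p)])° !=set0)
    (eigenA : char_poly A = \prod_(l <- lambda) ('X - l%:P)) :
  (exists B, is_bspline (n - 3)%N lambda B) /\
  forall B, is_bspline (n - 3)%N lambda B ->
    ae_eq (@planar_lebesgue R) setT (numerical_density A) B.
Proof.
have nc := interior_noncollinear normalA interiorA.
have n3 := noncollinear_geq3 nc.
case: n A normalA interiorA eigenA nc n3 => [|[|[|k]]]// A nA iA eigenA nc _.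
have -> : (k.+3 - 3)%N = k by rewrite !subSS subn0.
have [ss [s sE]] := spectral_perm nA eigenA.
pose knot (i : 'I_k.+3) := to_plane lambda`_i.
have knotE i : to_plane (spectral_diag A 0 i) = knot (s i) by rewrite sE.
(* The density formula for vertices listed in the order of [lambda]; the permutation [s] restores
   the spectral order. *)
have unit_knots (v : 'I_k.+3 -> 'rV[R]_(2 + k)) : homogeneous_mx (v \o s) \in unitmx ->
    (forall i, lsubmx (v i) = row2 (knot i)) -> 
    [/\ (0 < volume (conv_hull v))%E, volume (conv_hull v) \is a fin_num &
     ae_eq (@planar_lebesgue R) setT (numerical_density A)
    (fun z => (fine (volume (conv_hull v)))^-1%:E * hull_section v z)%E].
  move=> uv kv.
  have kvs i : lsubmx ((v \o s) i) = row2 (to_plane (spectral_diag A 0 i)).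
    by rewrite /= kv knotE.
  rewrite -(conv_hull_perm v s); split.
  - exact: volume_conv_hull_gt0 nA uv kvs.
  - exact: volume_conv_hull_fin_num nA uv kvs.
  - have := numerical_density_section nA uv kvs.
    by rewrite /hull_section conv_hull_perm.
have [v0 uv0 kv0] := exists_lift nc.
pose v (i : 'I_k.+3) : 'rV[R]_(2 + k) := v0 ((s^-1)%g i).
have vs : v \o s = v0 by apply/funext => i; rewrite /v /= permK.
have kv i : lsubmx (v i) = row2 (knot i) by rewrite kv0 knotE permKV.
have uv : homogeneous_mx (v \o s) \in unitmx by rewrite vs.
have [vol0 volf dv] := unit_knots v uv kv.
case: k => [|k] in A nA iA eigenA nc ss s sE knot knotE unit_knots v0 uv0 kv0
    v vs kv uv vol0 volf dv *.
  (* In degree zero the vertices are the knots themselves, and the section is the indicator of their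
     triangle. *)
  have vE : v = @row2 R \o knot :> ('I_3 -> 'rV[R]_2) by exact: lift0E kv.
  split; first by eexists; split; [exact: ss|].
  move=> B [_ /= ->]; move: dv; rewrite vE.
  by under [in X in ae_eq _ _ _ X -> _]eq_fun do rewrite hull_section0 -EFinM.
split.
  have [w kw w1] := exists_unit_lift vol0 volf.
  exists (hull_section w); split; first exact: ss.
  by exists w => //; split => // i; rewrite kw.
move=> B [_ /= [w [kw w1] ->]].
(* Any lift of unit volume is nondegenerate, so the density formula applies to it, with constant
   one. *)
have uw : homogeneous_mx (w \o s) \in unitmx.
  by apply: conv_hull_unit; rewrite conv_hull_perm w1.
have [_ _] := unit_knots w uw kw; rewrite w1 invr1.
by under [in X in ae_eq _ _ _ X -> _]eq_fun do rewrite mul1e.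
Qed.
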